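(* In a penny graph with vertices in general position, every vertex of degree $4$ has an unpopular neighbor that does not belong to a kernel.
   Context: A penny graph is a graph whose vertex set is a finite set $P$ of points in the Euclidean plane such that every two distinct points of $P$ are at distance at least $1$, and whose edges are exactly the pairs of points of $P$ at distance exactly $1$. The vertices are in general position if no three of them are collinear. A vertex is popular if it has degree $5$, at most one of its neighbors has degree $4$, and all its other neighbors have degree $5$; a vertex is unpopular otherwise. A kernel is a set of four vertices $L,U,R,D$, each of degree $5$, such that $LU, UR, RD, DL, LR$ are all edges. *)

(* Defs.v *)
From HB Require Import structures.
From mathcomp Require Import all_boot all_order all_algebra finmap reals.

Set Implicit Arguments.
Unset Strict Implicit.
Unset Printing Implicit Defensive.

Import Order.TTheory GRing.Theory Num.Theory.
Local Open Scope fset_scope.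
Local Open Scope ring_scope.

Section PennyGraph.
Variable R : realType.

(* The Euclidean plane is the bare product [R * R]; its distance is defined
   here because the library norm on a product is the maximum norm. *)
Definition edist (p q : R * R) : R :=
  Num.sqrt ((p.1 - q.1) ^+ 2 + (p.2 - q.2) ^+ 2).

Definition on_line (a b c : R) (p : R * R) : Prop := a * p.1 + b * p.2 = c.

Definition collinear (p q r : R * R) : Prop :=
  exists a b c : R,
    (a, b) <> (0, 0) /\ [/\ on_line a b c p, on_line a b c q & on_line a b c r].

Definition general_position (P : {fset R * R}) : Prop :=
  forall p q r, p \in P -> q \in P -> r \in P ->
    p <> q -> p <> r -> q <> r -> ~ collinear p q r.

(* A penny graph is determined by its vertex set [P]: the graph on [P] has
   edges [edge P]. *)
Definition penny_graph (P : {fset R * R}) : Prop :=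
  forall p q, p \in P -> q \in P -> p <> q -> 1 <= edist p q.

Definition edge (P : {fset R * R}) (p q : R * R) : bool :=
  [&& p \in P, q \in P & edist p q == 1].

Definition neighbors (P : {fset R * R}) (v : R * R) : {fset R * R} :=
  [fset u in P | edge P v u].

Definition degree (P : {fset R * R}) (v : R * R) : nat := #|` neighbors P v|.

Definition popular (P : {fset R * R}) (v : R * R) : Prop :=
  [/\ degree P v = 5%N,
      (#|` [fset u in neighbors P v | degree P u == 4%N]| <= 1)%N &
      forall u, u \in neighbors P v -> degree P u <> 4%N -> degree P u = 5%N].

Definition unpopular (P : {fset R * R}) (v : R * R) : Prop := ~ popular P v.

Definition kernel (P K : {fset R * R}) : Prop :=
  exists l u r d : R * R,
    [/\ K = [fset l; u; r; d], #|` K| = 4%N,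
        forall x, x \in K -> x \in P /\ degree P x = 5%N &
        [/\ edge P l u, edge P u r, edge P r d, edge P d l & edge P l r]].

End PennyGraph.

(* Main.v *)
Require Import Defs.
From mathcomp Require Import all_boot all_order all_algebra finmap reals.
From mathcomp Require Import boolp trigo ring lra.

Set Implicit Arguments.
Unset Strict Implicit.
Unset Printing Implicit Defensive.

Import Order.TTheory GRing.Theory Num.Theory.
Local Open Scope fset_scope.
Local Open Scope ring_scope.

(** All angles around a vertex are at least 60 degrees, and general position
    forbids an angle of 180, so at a vertex of degree 5 the five angles between
    consecutive neighbors exceed 60 degrees by 60 in total and no three
    consecutive ones are equal to 60.  If [wx] is an edge on a face that is not a
    triangle, the two angles of that face at [w] and [x] sum to at least 180,
    with equality only for a rhombus.  Adding these inequalities shows that an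
    edge between two vertices of degree 5 lies in a triangle, and that a kernel is
    rigid: every wide angle at one of its vertices belongs to a rhombus.

    Suppose that all neighbors of a vertex [v] of degree 4 are popular or in a
    kernel, and look at which of the four angles at [v] are equal to 60.  Each of
    the possible patterns is refuted by adding angle inequalities at the second
    neighborhood of [v], together with one more estimate: five points joined by
    four unit segments, with the three angles summing to at most 300 degrees, have
    their ends at distance less than 1, so that the ends coincide and the path
    closes up to a rhombus.  In the last pattern (two opposite angles of 60
    degrees) the only configuration compatible with all inequalities contains
    three collinear vertices. *)

(** * Rotations of the plane *)

Section PlaneRotation.
Variable R : realType.
Implicit Types (p q w x y : R * R) (a b g h u : R) (s : bool).

Local Notation th := (pi / 3 : R).

Definition dist2 p q : R := (p.1 - q.1) ^+ 2 + (p.2 - q.2) ^+ 2.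

(** The image of [x] under the counterclockwise rotation by [a] about [w]. *)
Definition turn w x a : R * R :=
  (w.1 + (cos a * (x.1 - w.1) - sin a * (x.2 - w.2)),
   w.2 + (sin a * (x.1 - w.1) + cos a * (x.2 - w.2))).

(** An orientation as a sign, so that each statement about direction [s] also covers its mirror
    image. *)
Definition sg s : R := if s then 1 else -1.

Lemma sgN s : sg (~~ s) = - sg s.
Proof. by case: s; rewrite /sg /= ?opprK. Qed.

Lemma cos_sgM s a : cos (sg s * a) = cos a.
Proof. by case: s; rewrite /sg ?mul1r // mulN1r cosN. Qed.

Lemma sin_sgM s a : sin (sg s * a) = sg s * sin a.
Proof. by case: s; rewrite /sg ?mul1r // !mulN1r sinN. Qed.

Lemma cos_lt a b : 0 <= a -> a < b -> b <= pi -> cos b < cos a.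
Proof.
move=> a0 ab bpi; rewrite ltr_cos // in_itv /=; apply/andP; split => //.
- exact: ltW (lt_le_trans ab bpi).
- exact: le_trans (ltW ab).
Qed.

Lemma cos_le a b : 0 <= a -> a <= b -> b <= pi -> cos b <= cos a.
Proof.
by move=> a0; rewrite le_eqVlt => /predU1P[-> //|ab] bpi; exact/ltW/cos_lt.
Qed.

(* cos (pi / 3) is a root of 4 X^3 - 3 X + 1 = (X + 1) (2 X - 1)^2. *)
Lemma cos_pi3 : cos th = 1 / 2.
Proof.
have p0 := pi_gt0 R.
have c0 : 0 < cos th by apply: cos_gt0_pihalf; apply/andP; split; lra.
have E : cos (th + th + th) = -1.
  by rewrite (_ : th + th + th = pi) ?cospi //; field.
have S := sin2cos2 th.
move: E; rewrite !(cosD, sinD) => E.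
have E2 : cos th ^+ 3 - 3 * cos th * sin th ^+ 2 = -1 by rewrite -E; ring.
rewrite S in E2.
have : (cos th + 1) * (2 * cos th - 1) ^+ 2 = 0.
  transitivity (cos th ^+ 3 - 3 * cos th * (1 - cos th ^+ 2) + 1); first by ring.
  by rewrite E2; ring.
move/eqP; rewrite mulf_eq0 expf_eq0 /= => /orP[/eqP|/eqP]; lra.
Qed.

Lemma cos_lt1 a : 0 < a -> a < 2 * pi -> cos a < 1.
Proof.
move=> a0 a2; have s0 : 0 < sin (a / 2) by apply: sin_gt0_pi; apply/andP; split; lra.
have := cosD (a / 2) (a / 2); rewrite -splitr -!expr2 => ->.
have := cos2Dsin2 (a / 2); have : 0 < sin (a / 2) ^+ 2 by rewrite exprn_gt0.
lra.
Qed.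

Lemma cos_eq1 a : - (2 * pi) < a -> a < 2 * pi -> cos a = 1 -> a = 0.
Proof.
move=> l1 l2 E; apply/eqP; case: (ltgtP a 0) => // n0.
- have : cos (- a) < 1 by apply: cos_lt1; lra.
  by rewrite cosN E ltxx.
- by have := cos_lt1 n0 l2; rewrite E ltxx.
Qed.

Lemma dist2_ge0 p q : 0 <= dist2 p q.
Proof. by rewrite addr_ge0 ?sqr_ge0. Qed.

Lemma dist2C p q : dist2 p q = dist2 q p.
Proof. by rewrite /dist2; ring. Qed.

Lemma turn0 w x : turn w x 0 = x.
Proof.
rewrite /turn cos0 sin0 (surjective_pairing x) /=; congr pair; ring.
Qed.

Lemma turnD w x a b : turn w (turn w x a) b = turn w x (a + b).
Proof. rewrite /turn /= cosD sinD; congr pair; ring. Qed.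

Lemma turn2pi s w x : turn w x (sg s * (2 * pi)) = x.
Proof.
have -> : 2 * pi = pi *+ 2 :> R by rewrite mulr_natl.
rewrite /turn cos_sgM sin_sgM cos2pi sin2pi (surjective_pairing x) /=.
by congr pair; ring.
Qed.

Lemma dist2_turn w x a : dist2 w (turn w x a) = dist2 w x.
Proof.
transitivity ((cos a ^+ 2 + sin a ^+ 2) * dist2 w x); last by rewrite cos2Dsin2 mul1r.
by rewrite /dist2 /turn /=; ring.
Qed.

Lemma dist2_turn2 w x a b :
  dist2 (turn w x a) (turn w x b) = (2 - 2 * cos (a - b)) * dist2 w x.
Proof.
have A := cos2Dsin2 a; have B := cos2Dsin2 b.
transitivity (((cos a ^+ 2 + sin a ^+ 2) + (cos b ^+ 2 + sin b ^+ 2)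
   - 2 * (cos a * cos b + sin a * sin b)) * dist2 w x).
  by rewrite /dist2 /turn /=; ring.
by rewrite A B cosB; ring.
Qed.

Lemma turn_inj s w x a b : dist2 w x = 1 -> - (2 * pi) < a - b -> a - b < 2 * pi ->
  turn w x (sg s * a) = turn w x (sg s * b) -> a = b.
Proof.
move=> d1 l1 l2 E; have := dist2_turn2 w x (sg s * a) (sg s * b).
rewrite E -mulrBr cos_sgM d1 /dist2 !subrr => E1.
apply/eqP; rewrite -subr_eq0; apply/eqP/cos_eq1 => //.
by move: E1; rewrite expr0n /=; lra.
Qed.

Lemma angle_exists (a b : R) : a ^+ 2 + b ^+ 2 = 1 ->
  exists t, [/\ - pi <= t, t <= pi, cos t = a & sin t = b].
Proof.
move=> E; have p0 := pi_gt0 R.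
have a1 : -1 <= a <= 1 by apply/andP; split; nra.
have [/andP[A0 Api] cA] := acos_def a1.
have sA := sin_acos a1.
have sE : Num.sqrt (1 - a ^+ 2) = `|b|.
  by rewrite -sqrtr_sqr; congr Num.sqrt; rewrite -E; ring.
case: (lerP 0 b) => b0.
- exists (acos a); split => //; first lra.
  by rewrite sA sE ger0_norm.
- exists (- acos a); split; [lra|lra|by rewrite cosN|].
  by rewrite sinN sA sE ltr0_norm // opprK.
Qed.

(** Angles range over (0, 2 pi], so [x] itself gets 2 pi and a sorted list of angles closes up on
    [x]. *)
Lemma turn_exists s w x y : dist2 w x = 1 -> dist2 w y = 1 ->
  exists a, [/\ 0 < a, a <= 2 * pi & y = turn w x (sg s * a)].
Proof.
move=> dx dy; have p0 := pi_gt0 R.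
pose d1 := x.1 - w.1; pose d2 := x.2 - w.2; pose e1 := y.1 - w.1; pose e2 := y.2 - w.2.
have D : d1 ^+ 2 + d2 ^+ 2 = 1 by rewrite -dx /dist2 /d1 /d2; ring.
have F : e1 ^+ 2 + e2 ^+ 2 = 1 by rewrite -dy /dist2 /e1 /e2; ring.
(* The inner and cross products of the two unit vectors are the cosine and sine of the angle. *)
have [|t [t1 t2 ct st]] := @angle_exists (d1 * e1 + d2 * e2) (d1 * e2 - d2 * e1).
  transitivity ((d1 ^+ 2 + d2 ^+ 2) * (e1 ^+ 2 + e2 ^+ 2)); first by ring.
  by rewrite D F mulr1.
have yE : y = turn w x t.
  rewrite /turn ct st -/d1 -/d2 [LHS]surjective_pairing; congr pair.
  - transitivity (w.1 + (d1 ^+ 2 + d2 ^+ 2) * e1); last by ring.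
    by rewrite D /e1; ring.
  - transitivity (w.2 + (d1 ^+ 2 + d2 ^+ 2) * e2); last by ring.
    by rewrite D /e2; ring.
have sgt : sg s * (sg s * t) = t by case: (s); rewrite /sg; ring.
case: (ltrP 0 (sg s * t)) => st0.
- exists (sg s * t); split => //; last by rewrite sgt.
  by case: (s) st0; rewrite /sg; lra.
- exists (sg s * t + 2 * pi); split; first by case: (s) st0; rewrite /sg; lra.
  + lra.
  + by rewrite mulrDr -turnD turn2pi sgt.
Qed.

End PlaneRotation.

(** * Angles between consecutive neighbors *)

Section Gaps.
Variables (R : realType) (P : {fset R * R}).
Implicit Types (p q w x y z : R * R) (a b g h u : R) (s : bool).

Local Notation th := (pi / 3 : R).

(* Around w, the neighbor of w that follows x in the direction s (counterclockwise
   if s = true) is y, at angle g; if x is the only neighbor of w, then y = x and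
   g = 2 pi. *)
Record gap s w x g y : Prop := Gap {
  gap_center : w \in P;
  gap_src : x \in P;
  gap_unit : dist2 w x = 1;
  gap_pos : 0 < g;
  gap_tgt : y \in P;
  gap_turn : y = turn w x (sg R s * g);
  gap_free : forall u, 0 < u -> u < g -> turn w x (sg R s * u) \notin P }.

Lemma gap_unit_tgt s w x g y : gap s w x g y -> dist2 w y = 1.
Proof. by case=> _ _ d1 _ _ -> _; rewrite dist2_turn. Qed.

Lemma gap_le s w x g y u : gap s w x g y -> 0 < u -> turn w x (sg R s * u) \in P -> g <= u.
Proof.
move=> G u0 inP; rewrite leNgt; apply/negP => ug.
by have := gap_free G u0 ug; rewrite inP.
Qed.

Lemma gap_uniq s w x g y g' y' : gap s w x g y -> gap s w x g' y' -> g = g' /\ y = y'.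
Proof.
move=> G G'; have E : g = g'.
  apply/eqP; rewrite eq_le; apply/andP; split.
  - by apply: (gap_le G) (gap_pos G') _; rewrite -(gap_turn G') (gap_tgt G').
  - by apply: (gap_le G') (gap_pos G) _; rewrite -(gap_turn G) (gap_tgt G).
by split=> //; rewrite (gap_turn G) (gap_turn G') E.
Qed.

Lemma gap_rev s w x g y : gap s w x g y -> gap (~~ s) w y g x.
Proof.
move=> G; have yE := gap_turn G; split.
- exact: gap_center G.
- exact: gap_tgt G.
- exact: gap_unit_tgt G.
- exact: gap_pos G.
- exact: gap_src G.
- by rewrite yE turnD sgN -mulrDl subrr mul0r turn0.
- move=> u u0 ug; rewrite yE turnD sgN.
  rewrite (_ : _ + _ = sg R s * (g - u)); last by ring.
  by apply: (gap_free G); lra.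
Qed.

Hypothesis penny : penny_graph P.

Lemma penny_dist2 p q : p \in P -> q \in P -> dist2 p q < 1 -> p = q.
Proof.
move=> pP qP lt1; have [//|/eqP ne] := eqVneq p q.
have := penny pP qP ne; rewrite /edist -/(dist2 p q).
by rewrite -[X in X <= _]sqrtr1 ler_sqrt ?ler01 ?dist2_ge0 // leNgt lt1.
Qed.

(** Points of a unit circle less than 60 degrees apart are at distance less than 1. *)
Lemma turn_ge s w x g : w \in P -> x \in P -> dist2 w x = 1 -> 0 < g -> g < 2 * pi ->
  turn w x (sg R s * g) \in P -> th <= g.
Proof.
move=> wP xP d1 g0 g2 yP; rewrite leNgt; apply/negP => gth.
have p0 := pi_gt0 R.
have : turn w x (sg R s * g) = turn w x (sg R s * 0).
  apply: penny_dist2 => //; first by rewrite mulr0 turn0.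
  rewrite dist2_turn2 d1 -mulrBr cos_sgM subr0.
  have : cos th < cos g by apply: cos_lt; lra.
  by rewrite cos_pi3; lra.
move/turn_inj => /(_ d1); have -> : g - 0 = g by ring.
by move=> /(_ _ _)E; have := E ltac:(lra) g2; lra.
Qed.

Lemma gap_ge s w x g y : gap s w x g y -> th <= g.
Proof.
move=> G; have p0 := pi_gt0 R; case: (ltrP g (2 * pi)) => g2; last by lra.
apply: (turn_ge (s := s) (gap_center G) (gap_src G) (gap_unit G) (gap_pos G) g2).
by rewrite -(gap_turn G) (gap_tgt G).
Qed.

(** A gap of 60 degrees closes an equilateral triangle. A vertex inside the gap at [x] would be less
    than 60 degrees from [y], against [turn_ge]. *)
Lemma gap_tri s w x y : gap s w x th y -> gap s x y th w.
Proof.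
move=> G; have p0 := pi_gt0 R.
have dxy : dist2 x y = 1.
  have := dist2_turn2 w x (sg R s * 0) (sg R s * th).
  rewrite -mulrBr cos_sgM sub0r cosN cos_pi3 (gap_unit G) mulr0 turn0 -(gap_turn G) => ->.
  by field.
split=> //; [exact: gap_src G|exact: gap_tgt G|exact: gap_pos G|exact: gap_center G| |].
- have cs := cos2Dsin2 th; rewrite cos_pi3 in cs.
  rewrite (gap_turn G) [LHS]surjective_pairing /turn /= !cos_sgM !sin_sgM cos_pi3.
  have sg2 : sg R s * sg R s = 1 by case: (s); rewrite /sg; ring.
  have ss : (sg R s * sin th) * (sg R s * sin th) = 3 / 4.
    transitivity ((sg R s * sg R s) * sin th ^+ 2); first by ring.
    by rewrite sg2; lra.
  congr pair.
  + transitivity (x.1 + (w.1 - x.1) * (1/4 + (sg R s * sin th) * (sg R s * sin th))); last by field.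
    by rewrite ss; field.
  + transitivity (x.2 + (w.2 - x.2) * (1/4 + (sg R s * sin th) * (sg R s * sin th))); last by field.
    by rewrite ss; field.
- move=> u u0 uth; apply/negP => uP.
  have := turn_ge (gap_src G) (gap_tgt G) dxy u0 ltac:(lra) uP.
  by rewrite leNgt uth.
Qed.

Lemma quad_turn s w x g h : dist2 w x = 1 ->
  dist2 (turn w x (sg R s * g)) (turn x w (sg R (~~ s) * h))
    = 3 - 2 * cos g - 2 * cos h + 2 * cos (g + h).
Proof.
move=> d1; rewrite cosD.
have sg2 : sg R s * sg R s = 1 by case: (s); rewrite /sg; ring.
transitivity ((1 + (cos g ^+ 2 + sg R s * sg R s * sin g ^+ 2)
  + (cos h ^+ 2 + sg R s * sg R s * sin h ^+ 2) - 2 * cos g - 2 * cos h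
  + 2 * (cos g * cos h - sg R s * sg R s * (sin g * sin h))) * dist2 w x).
  rewrite /dist2 /turn /= !cos_sgM !sin_sgM sgN; ring.
by rewrite d1 sg2 !mul1r !cos2Dsin2; ring.
Qed.

(** Both gaps lie on the same side of the edge [wx]. If they sum to less than pi, then [p] and [q]
    are closer than 1, hence equal, and the face is an equilateral triangle. *)
Lemma gap_edge s w x g h p q : gap s w x g p -> gap (~~ s) x w h q ->
  (g = th /\ h = th) \/ [/\ th < g, th < h & pi <= g + h].
Proof.
move=> G H; have p0 := pi_gt0 R.
have gg := gap_ge G; have hh := gap_ge H.
have tri_of s' w' x' g' h' p' q' : gap s' w' x' g' p' -> gap (~~ s') x' w' h' q' ->
    g' = th -> h' = th.
  move=> G' H' gE; rewrite gE in G'.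
  by have [-> _] := gap_uniq H' (gap_rev (gap_tri G')).
case: (ltrP (g + h) pi) => ghpi; last first.
  right; split=> //.
  - rewrite lt_neqAle gg andbT; apply/eqP => E; have := tri_of _ _ _ _ _ _ _ G H (esym E); lra.
  - rewrite lt_neqAle hh andbT; apply/eqP => E.
    have G' : gap (~~ ~~ s) w x g p by rewrite negbK.
    by have := tri_of _ _ _ _ _ _ _ H G' (esym E); lra.
left.
have d1 := gap_unit G.
have E : p = q.
  apply: penny_dist2; [exact: gap_tgt G|exact: gap_tgt H|].
  rewrite (gap_turn G) (gap_turn H) (quad_turn s g h d1).
  (* With half sum f and half difference d, the squared distance is 1 - 4 cos f (cos d - cos f),
     where 0 < cos f < cos d. *)
  have c1 : cos ((g + h) / 2) < cos (`|(g - h) / 2|).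
    apply: cos_lt; [by rewrite normr_ge0| |lra].
    by rewrite ltr_norml; apply/andP; split; lra.
  rewrite cos_norm in c1.
  have c2 : 0 < cos ((g + h) / 2) by apply: cos_gt0_pihalf; apply/andP; split; lra.
  have -> : cos (g + h) = 2 * cos ((g + h) / 2) ^+ 2 - 1.
    by rewrite {1}(splitr (g + h)) cosD -!expr2 sin2cos2; ring.
  have -> : 3 - 2 * cos g - 2 * cos h = 3 - 4 * (cos ((g + h) / 2) * cos ((g - h) / 2)).
    have := cosD ((g + h) / 2) ((g - h) / 2).
    rewrite (_ : (g + h) / 2 + (g - h) / 2 = g); last by field.
    have := cosB ((g + h) / 2) ((g - h) / 2).
    rewrite (_ : (g + h) / 2 - (g - h) / 2 = h); last by field.
    by move=> -> ->; ring.
  by nra.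
have angle_th (w' x' : R * R) a : dist2 w' x' = 1 -> dist2 (turn w' x' a) x' = 1 -> cos a = 1 / 2.
  move=> dd; have := dist2_turn2 w' x' a 0; rewrite turn0 subr0 dd => ->; lra.
have cth a : th <= a -> a < pi -> cos a = 1 / 2 -> a = th.
  move=> a1 a2; rewrite -cos_pi3 => /cos_inj; apply; rewrite in_itv /=; apply/andP; split; lra.
split.
- apply: cth => //; first lra.
  rewrite -(cos_sgM s); apply: (angle_th w x) => //.
  by rewrite -(gap_turn G) E dist2C (gap_unit_tgt H).
- apply: cth => //; first lra.
  rewrite -(cos_sgM (~~ s)); apply: (angle_th x w); first by rewrite dist2C.
  by rewrite -(gap_turn H) -E dist2C (gap_unit_tgt G).
Qed.

(** Angles summing to pi make the two outer segments parallel. *)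
Lemma turn_rhombus s w x g h : g + h = pi ->
  turn x w (sg R (~~ s) * h) = turn w x (sg R s * g) + x - w.
Proof.
move=> E; have -> : h = pi - g by lra.
rewrite /turn !cos_sgM !sin_sgM sgN cosB sinB cospi sinpi [RHS]surjective_pairing /=.
by congr pair; ring.
Qed.

Lemma gap_rhombus s w x g h p q : gap s w x g p -> gap (~~ s) x w h q ->
  g + h = pi -> q = p + x - w.
Proof. by move=> G H E; rewrite (gap_turn G) (gap_turn H) (turn_rhombus s w x E). Qed.

(** The fourth corner is seen from [x] at angle [pi - g], which bounds [h] from above; [gap_edge]
    bounds it from below. *)
Lemma gap_of_rhombus s w x g h p q : gap s w x g p -> gap (~~ s) x w h q ->
  th < g -> g < pi -> p + x - w \in P -> g + h = pi.
Proof.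
move=> G H tg gp inP; have [[E _]|[_ _ gh]] := gap_edge G H; first lra.
suff : h <= pi - g by lra.
apply: (gap_le H); first lra.
have E : g + (pi - g) = pi by ring.
by rewrite (turn_rhombus s w x E) -(gap_turn G).
Qed.

Hypothesis gen : general_position P.

(** A vertex opposite to [x] would lie on the line through [w] and [x]. *)
Lemma antipodal w x : w \in P -> x \in P -> dist2 w x = 1 ->
  turn w x pi \in P -> False.
Proof.
move=> wP xP d1 yP; have p0 := pi_gt0 R.
have d2 := dist2_turn w x pi.
have ne p q : dist2 p q = 1 -> p <> q.
  by move=> D E; move: D; rewrite E /dist2 !subrr expr0n /= addr0 => /eqP; rewrite eq_sym oner_eq0.
apply: (gen wP xP yP); [exact: ne|by apply: ne; rewrite d2| |].
  move=> E; have := dist2_turn2 w x 0 pi; rewrite turn0 -E sub0r cosN cospi d1 /dist2 !subrr expr0n /=; lra.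
exists (x.2 - w.2), (w.1 - x.1), ((x.2 - w.2) * w.1 + (w.1 - x.1) * w.2); split.
  by case=> A B; move: d1; rewrite /dist2 B -opprB A oppr0 expr0n /= addr0 => /eqP; rewrite eq_sym oner_eq0.
by rewrite /on_line /turn /= cospi sinpi; split=> //; ring.
Qed.

Lemma antipodal_sg s w x a : w \in P -> x \in P -> dist2 w x = 1 ->
  turn w x (sg R s * a) \in P -> a = pi -> False.
Proof.
move=> wP xP d1 yP E; apply: (antipodal wP xP d1).
suff <- : turn w x (sg R s * a) = turn w x pi by [].
by rewrite E /turn cos_sgM sin_sgM sinpi mulr0.
Qed.

Lemma gap2 s w x y z g1 g2 : gap s w x g1 y -> gap s w y g2 z -> g1 + g2 <> pi.
Proof.
move=> G1 G2; apply: (antipodal_sg (s := s) (gap_center G1) (gap_src G1) (gap_unit G1)).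
by rewrite mulrDr -turnD -(gap_turn G1) -(gap_turn G2) (gap_tgt G2).
Qed.

Lemma gap3 s w x y z t g1 g2 g3 : gap s w x g1 y -> gap s w y g2 z -> gap s w z g3 t ->
  g1 + g2 + g3 <> pi.
Proof.
move=> G1 G2 G3; apply: (antipodal_sg (s := s) (gap_center G1) (gap_src G1) (gap_unit G1)).
by rewrite !mulrDr -!turnD -(gap_turn G1) -(gap_turn G2) -(gap_turn G3) (gap_tgt G3).
Qed.

End Gaps.

(** * The neighbors of a vertex in cyclic order *)

Section Fans.
Variables (R : realType) (P : {fset R * R}).
Implicit Types (p q w x y z v : R * R) (a b g h u : R) (s : bool).

Local Notation th := (pi / 3 : R).
Local Notation gap := (gap P).

Lemma edgeE p q : edge P p q <-> [/\ p \in P, q \in P & dist2 p q = 1].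
Proof.
rewrite /edge /edist -/(dist2 p q); split.
- case/and3P=> pP qP /eqP E; split=> //.
  by rewrite -[LHS]sqr_sqrtr ?dist2_ge0 // E expr1n.
- by case=> -> -> ->; rewrite sqrtr1 eqxx.
Qed.

Lemma neighborsE w y : (y \in neighbors P w) <-> [/\ w \in P, y \in P & dist2 w y = 1].
Proof.
rewrite /neighbors !inE -edgeE; split=> [/andP[]//|E].
by rewrite E andbT; case/edgeE: E.
Qed.

(** A neighbor is recovered from its angle, so the sorted list of angles has as many entries as
    there are neighbors. *)
Lemma offsets s w x : w \in P -> x \in P -> dist2 w x = 1 ->
  exists L : seq R, [/\ sorted <%R L, size L = degree P w &
    forall u, (u \in L) = [&& 0 < u, u <= 2 * pi & turn w x (sg R s * u) \in P]].
Proof.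
move=> wP xP d1; have p0 := pi_gt0 R.
have /choice[f fP] : forall y, exists a, y \in neighbors P w ->
    [/\ 0 < a, a <= 2 * pi & y = turn w x (sg R s * a)].
  move=> y; case: (boolP (y \in neighbors P w)) => [/neighborsE[_ yP dy]|_].
  - by have [a aP] := turn_exists s d1 dy; exists a.
  - by exists 0.
have inL u : (u \in [seq f y | y <- neighbors P w])
    = [&& 0 < u, u <= 2 * pi & turn w x (sg R s * u) \in P].
  apply/mapP/and3P => [[y yN ->]|[u0 u2 uP]].
    have [f0 f2 yE] := fP y yN; split=> //.
    by rewrite -yE; case/neighborsE: yN.
  have yN : turn w x (sg R s * u) \in neighbors P w.
    by apply/neighborsE; split=> //; rewrite dist2_turn.
  exists (turn w x (sg R s * u)) => //; have [f0 f2 yE] := fP _ yN.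
  by apply: (turn_inj (s := s) d1) => //; lra.
exists (sort <=%R [seq f y | y <- neighbors P w]); split.
- rewrite sort_lt_sorted map_inj_in_uniq ?fset_uniq // => y z yN zN E.
  by have [_ _ ->] := fP y yN; have [_ _ ->] := fP z zN; rewrite E.
- by rewrite size_sort size_map.
- by move=> u; rewrite mem_sort.
Qed.

Lemma gap_between s w x a b : w \in P -> dist2 w x = 1 ->
  turn w x (sg R s * a) \in P -> turn w x (sg R s * b) \in P -> a < b ->
  (forall u, a < u -> u < b -> turn w x (sg R s * u) \notin P) ->
  gap s w (turn w x (sg R s * a)) (b - a) (turn w x (sg R s * b)).
Proof.
move=> wP d1 aP bP ab free; split=> //.
- by rewrite dist2_turn.
- by rewrite subr_gt0.
- by rewrite turnD -mulrDr addrC subrK.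
- by move=> u u0 ub; rewrite turnD -mulrDr; apply: free; lra.
Qed.

Record fan4 s w x1 x2 x3 x4 g1 g2 g3 g4 : Prop := Fan4 {
  fan4_1 : gap s w x1 g1 x2; fan4_2 : gap s w x2 g2 x3;
  fan4_3 : gap s w x3 g3 x4; fan4_4 : gap s w x4 g4 x1;
  fan4_sum : g1 + g2 + g3 + g4 = 2 * pi }.

Record fan5 s w x1 x2 x3 x4 x5 g1 g2 g3 g4 g5 : Prop := Fan5 {
  fan5_1 : gap s w x1 g1 x2; fan5_2 : gap s w x2 g2 x3;
  fan5_3 : gap s w x3 g3 x4; fan5_4 : gap s w x4 g4 x5;
  fan5_5 : gap s w x5 g5 x1;
  fan5_sum : g1 + g2 + g3 + g4 + g5 = 2 * pi;
  fan5_all : forall y, edge P w y -> y \in [:: x1; x2; x3; x4; x5] }.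

Lemma fan4_exists s w x : edge P w x -> degree P w = 4%N ->
  exists x2 x3 x4 g1 g2 g3 g4, fan4 s w x x2 x3 x4 g1 g2 g3 g4.
Proof.
move=> /edgeE[wP xP d1] deg; have p0 := pi_gt0 R.
have [L [srt sz LP]] := offsets s wP xP d1.
have x0 : turn w x (sg R s * 0) = x by rewrite mulr0 turn0.
have in2 : 2 * pi \in L by rewrite LP lexx turn2pi xP andbT /=; lra.
rewrite deg in sz.
case: L sz srt LP in2 => [|a1 [|a2 [|a3 [|a4 []]]]] //= _ /and4P[l12 l23 l34 _] LP in2.
have inP a : a \in [:: a1; a2; a3; a4] -> [/\ 0 < a, a <= 2 * pi & turn w x (sg R s * a) \in P].
  by rewrite LP => /and3P.
have [a1p _ a1P] := inP a1 ltac:(by rewrite !inE eqxx ?orbT).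
have [_ _ a2P] := inP a2 ltac:(by rewrite !inE eqxx ?orbT).
have [_ _ a3P] := inP a3 ltac:(by rewrite !inE eqxx ?orbT).
have [_ a42 a4P] := inP a4 ltac:(by rewrite !inE eqxx ?orbT).
(* The largest angle is that of [x] itself; the first gap starts from [x] at angle 0. *)
have a4E : a4 = 2 * pi by move: in2; rewrite !inE => /or4P[]/eqP E; lra.
have free u : 0 < u -> u < 2 * pi -> u != a1 -> u != a2 -> u != a3 ->
    turn w x (sg R s * u) \notin P.
  move=> u0 u2 n1 n2 n3; apply/negP => uP.
  have : u \in [:: a1; a2; a3; a4] by rewrite LP u0 uP andbT /=; lra.
  rewrite !inE (negPf n1) (negPf n2) (negPf n3) /= => /eqP E; lra.
exists (turn w x (sg R s * a1)), (turn w x (sg R s * a2)), (turn w x (sg R s * a3)).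
exists (a1 - 0), (a2 - a1), (a3 - a2), (a4 - a3).
split; last by rewrite a4E; ring.
- rewrite -{1}x0; apply: gap_between => //; first by rewrite x0.
  by move=> u u1 u2; apply: free; lra.
- by apply: gap_between => // u u1 u2; apply: free; lra.
- by apply: gap_between => // u u1 u2; apply: free; lra.
- have {2}-> : x = turn w x (sg R s * a4) by rewrite a4E turn2pi.
  by apply: gap_between => // u u1 u2; apply: free; lra.
Qed.

Lemma fan5_exists s w x : edge P w x -> degree P w = 5%N ->
  exists x2 x3 x4 x5 g1 g2 g3 g4 g5, fan5 s w x x2 x3 x4 x5 g1 g2 g3 g4 g5.
Proof.
move=> /edgeE[wP xP d1] deg; have p0 := pi_gt0 R.
have [L [srt sz LP]] := offsets s wP xP d1.
have x0 : turn w x (sg R s * 0) = x by rewrite mulr0 turn0.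
have in2 : 2 * pi \in L by rewrite LP lexx turn2pi xP andbT /=; lra.
rewrite deg in sz.
case: L sz srt LP in2 => [|a1 [|a2 [|a3 [|a4 [|a5 []]]]]] //= _ /and5P[l12 l23 l34 l45 _] LP in2.
have inP a : a \in [:: a1; a2; a3; a4; a5] -> [/\ 0 < a, a <= 2 * pi & turn w x (sg R s * a) \in P].
  by rewrite LP => /and3P.
have [a1p _ a1P] := inP a1 ltac:(by rewrite !inE eqxx ?orbT).
have [_ _ a2P] := inP a2 ltac:(by rewrite !inE eqxx ?orbT).
have [_ _ a3P] := inP a3 ltac:(by rewrite !inE eqxx ?orbT).
have [_ _ a4P] := inP a4 ltac:(by rewrite !inE eqxx ?orbT).
have [_ a52 a5P] := inP a5 ltac:(by rewrite !inE eqxx ?orbT).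
have a5E : a5 = 2 * pi by move: in2; rewrite !inE => /or4P[| | |/orP[]]/eqP E; lra.
have free u : 0 < u -> u < 2 * pi -> u != a1 -> u != a2 -> u != a3 -> u != a4 ->
    turn w x (sg R s * u) \notin P.
  move=> u0 u2 n1 n2 n3 n4; apply/negP => uP.
  have : u \in [:: a1; a2; a3; a4; a5] by rewrite LP u0 uP andbT /=; lra.
  rewrite !inE (negPf n1) (negPf n2) (negPf n3) (negPf n4) /= => /eqP E; lra.
exists (turn w x (sg R s * a1)), (turn w x (sg R s * a2)), (turn w x (sg R s * a3)),
  (turn w x (sg R s * a4)).
exists (a1 - 0), (a2 - a1), (a3 - a2), (a4 - a3), (a5 - a4).
have xE : x = turn w x (sg R s * a5) by rewrite a5E turn2pi.
split.
- rewrite -{1}x0; apply: gap_between => //; first by rewrite x0.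
  by move=> u u1 u2; apply: free; lra.
- by apply: gap_between => // u u1 u2; apply: free; lra.
- by apply: gap_between => // u u1 u2; apply: free; lra.
- by apply: gap_between => // u u1 u2; apply: free; lra.
- rewrite {2}xE.
  by apply: gap_between => // u u1 u2; apply: free; lra.
- by rewrite a5E; ring.
- move=> y /edgeE[_ yP dy]; have [a [a0 a2' yE]] := turn_exists s d1 dy.
  have : a \in [:: a1; a2; a3; a4; a5] by rewrite LP a0 a2' -yE yP.
  rewrite !inE => /or4P[| | |/orP[]]/eqP E; rewrite yE E -?xE eqxx ?orbT //.
Qed.

End Fans.

(** * Paths of four unit segments *)

Section Chain.
Variable R : realType.
Implicit Types (v w : R * R) (A B T : R) (s : bool).

Local Notation th := (pi / 3 : R).

(** The ends of a path of four unit segments with middle vertex [v], angle [T] at [v], and angles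
    [A] and [B] at [w] and [w'], all on the same side. *)
Lemma chain_dist2 s v w w' A B T : dist2 v w = 1 -> w' = turn v w (sg R s * T) ->
  dist2 (turn w v (sg R (~~ s) * A)) (turn w' v (sg R s * B))
    = 4 * (1 + cos ((A - B) / 2) * cos (T + (A + B) / 2)
           - cos ((A + B) / 2) * (cos ((A - B) / 2) + cos (T + (A + B) / 2))).
Proof.
move=> d1 ->; transitivity (4 - 2 * cos A - 2 * cos B - 2 * cos T
    + 2 * cos (T + B) + 2 * cos (A + T) - 2 * cos (A + T + B)); last first.
  (* In terms of [n], [f] and [T + f], the addition formulas turn the sum of cosines into
     products. *)
  set n := (A - B) / 2; set f := (A + B) / 2.
  have -> : A + T + B = (T + f) + f by rewrite /f; field.
  have -> : A + T = (T + f) + n by rewrite /f /n; field.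
  have -> : T + B = (T + f) - n by rewrite /f /n; field.
  have {1}-> : T = (T + f) - f by ring.
  have -> : A = f + n by rewrite /f /n; field.
  have -> : B = f - n by rewrite /f /n; field.
  by move: (T + f) => t; rewrite !(cosB, cosD); ring.
have sg2 : sg R s * sg R s = 1 by case: (s); rewrite /sg; ring.
have sgM a b : (sg R s * a) * (sg R s * b) = a * b.
  by transitivity (sg R s * sg R s * (a * b)); [ring|rewrite sg2 mul1r].
have sgQ a : cos a ^+ 2 + (sg R s * sin a) ^+ 2 = 1.
  by rewrite [X in _ + X = _]expr2 sgM -expr2 cos2Dsin2.
have QA := sgQ A; have QB := sgQ B; have QT := sgQ T.
have -> : cos (A + T + B) = cos A * (cos T * cos B - (sg R s * sin T) * (sg R s * sin B))
    - (sg R s * sin A) * ((sg R s * sin T) * cos B + cos T * (sg R s * sin B)).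
  rewrite -addrA !(cosD, sinD).
  transitivity (cos A * (cos T * cos B - (sg R s * sg R s) * (sin T * sin B))
    - (sg R s * sg R s) * (sin A * (sin T * cos B + cos T * sin B))); last by ring.
  by rewrite sg2 !mul1r.
have -> : cos (T + B) = cos T * cos B - (sg R s * sin T) * (sg R s * sin B) by rewrite sgM cosD.
have -> : cos (A + T) = cos A * cos T - (sg R s * sin A) * (sg R s * sin T) by rewrite sgM cosD.
rewrite /dist2 /turn /= !cos_sgM !sin_sgM sgN !mulNr.
move: (sg R s * sin A) (sg R s * sin B) (sg R s * sin T) (cos A) (cos B) (cos T) QA QB QT.
move=> sA sB sT cA cB cT QA QB QT.
transitivity ((1 + (cA ^+ 2 + sA ^+ 2) + (cT ^+ 2 + sT ^+ 2)
  + (cT ^+ 2 + sT ^+ 2) * (cB ^+ 2 + sB ^+ 2) - 2 * cA - 2 * (cT ^+ 2 + sT ^+ 2) * cB - 2 * cT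
  + 2 * (cT * cB - sT * sB) + 2 * (cA * cT - sA * sT)
  - 2 * (cA * (cT * cB - sT * sB) - sA * (sT * cB + cT * sB))) * dist2 v w).
  by rewrite /dist2; ring.
by rewrite QA QB QT d1; ring.
Qed.

(* For fixed T + (A + B) / 2 and A - B the squared length is largest when
   A + T + B = 5 pi / 3; there, with m = 4 pi / 3 - T - (A + B) / 2 and
   n = (A - B) / 2, it equals 1 - 4 cos m (cos n - cos m). *)
Lemma chain_lt1 A B T : th < A -> th < B -> A < pi -> B < pi -> th <= T -> pi <= A + T -> pi <= B + T ->
  A + T + B <= 5 * th ->
  4 * (1 + cos ((A - B) / 2) * cos (T + (A + B) / 2)
           - cos ((A + B) / 2) * (cos ((A - B) / 2) + cos (T + (A + B) / 2))) < 1.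
Proof.
move=> A1 B1 Api Bpi T1 AT BT S; have p0 := pi_gt0 R.
pose n := (A - B) / 2; pose m := 4 * th - (T + (A + B) / 2).
have tE : T + (A + B) / 2 = pi + (th - m) by rewrite /m; field.
have mn : `|n| < m by rewrite ltr_norml /n /m; apply/andP; split; lra.
have m2 : m <= th by rewrite /m; lra.
have cm : 0 < cos m.
  by have n0 : 0 <= `|n| by []; apply: cos_gt0_pihalf; apply/andP; split; lra.
have cmn : cos m < cos n by rewrite -(cos_norm n); apply: cos_lt => //; lra.
have -> : cos (T + (A + B) / 2) = - cos (th - m).
  by rewrite tE cosD cospi sinpi; ring.
rewrite -/n.
have cn : cos (th - m) <= cos n.
  rewrite -(cos_norm n); apply: cos_le => //; last by lra.
  by rewrite ler_norml /n /m; apply/andP; split; lra.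
have cphi : cos (th + m) <= cos ((A + B) / 2).
  by have n0 : 0 <= `|n| by []; apply: cos_le; rewrite /m; lra.
(* As cos n - cos (th - m) is nonnegative by [cn], replacing cos ((A + B) / 2) by the smaller cos
   (th + m) can only increase the value. *)
apply: (@le_lt_trans _ _ (4 * (1 + cos n * - cos (th - m) - cos (th + m) * (cos n + - cos (th - m))))).
  by nra.
have -> : 4 * (1 + cos n * - cos (th - m) - cos (th + m) * (cos n + - cos (th - m)))
   = 4 * (1 - cos n * (cos (th - m) + cos (th + m)) + cos (th + m) * cos (th - m)) by ring.
have S1 := sin2cos2 m; have S2 := sin2cos2 th.
have -> : cos (th - m) + cos (th + m) = cos m by rewrite cosB cosD cos_pi3; field.
have -> : cos (th + m) * cos (th - m) = cos m ^+ 2 - 3 / 4.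
  rewrite cosB cosD.
  transitivity (cos th ^+ 2 * cos m ^+ 2 - sin th ^+ 2 * sin m ^+ 2); first by ring.
  by rewrite S1 S2 cos_pi3; field.
by nra.
Qed.

End Chain.

(** * Vertices of degree 5 and kernels *)

Section Kernels.
Variables (R : realType) (P : {fset R * R}).
Hypotheses (penny : penny_graph P) (gen : general_position P).
Implicit Types (p q w x y z v : R * R) (a b g h u A B T : R) (s : bool).

Local Notation th := (pi / 3 : R).
Local Notation gap := (gap P).
Local Notation fan5 := (fan5 P).
Local Notation deg := (degree P).

(** Two unit circles with distinct centers meet in at most two points. Seen from [v], the vector [q]
    is orthogonal to [d - e], hence parallel to [d + e], and then of the same length. *)
Lemma rhombus_apex v w w' p : dist2 v w = 1 -> dist2 v w' = 1 ->
  dist2 w p = 1 -> dist2 w' p = 1 -> w <> w' -> p <> v -> p = w + w' - v.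
Proof.
case: v w w' p => [v1 v2] [w1 w2] [y1 y2] [p1 p2]; rewrite /dist2 /=.
move=> dw dy wp yp ne pv.
pose d1 := w1 - v1; pose d2 := w2 - v2; pose e1 := y1 - v1; pose e2 := y2 - v2.
pose q1 := p1 - v1; pose q2 := p2 - v2.
have D : d1 ^+ 2 + d2 ^+ 2 = 1 by rewrite -dw /d1 /d2; ring.
have E : e1 ^+ 2 + e2 ^+ 2 = 1 by rewrite -dy /e1 /e2; ring.
have QD : q1 ^+ 2 + q2 ^+ 2 = 2 * (q1 * d1 + q2 * d2).
  have : (q1 - d1) ^+ 2 + (q2 - d2) ^+ 2 = 1 by rewrite -wp /q1 /q2 /d1 /d2; ring.
  by move: D; lra.
have QE : q1 ^+ 2 + q2 ^+ 2 = 2 * (q1 * e1 + q2 * e2).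
  have : (q1 - e1) ^+ 2 + (q2 - e2) ^+ 2 = 1 by rewrite -yp /q1 /q2 /e1 /e2; ring.
  by move: E; lra.
have ort : q1 * (d1 - e1) + q2 * (d2 - e2) = 0 by lra.
have ort2 : (d1 + e1) * (d1 - e1) + (d2 + e2) * (d2 - e2) = 0.
  by transitivity ((d1 ^+ 2 + d2 ^+ 2) - (e1 ^+ 2 + e2 ^+ 2)); [ring|rewrite D E subrr].
have par : q1 * (d2 + e2) - q2 * (d1 + e1) = 0.
  have : (q1 * (d2 + e2) - q2 * (d1 + e1)) * ((d1 - e1) ^+ 2 + (d2 - e2) ^+ 2) = 0.
    transitivity ((q1 * (d1 - e1) + q2 * (d2 - e2)) * ((d2 + e2) * (d1 - e1) - (d1 + e1) * (d2 - e2))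
      - (q2 * (d1 - e1) - q1 * (d2 - e2)) * ((d1 + e1) * (d1 - e1) + (d2 + e2) * (d2 - e2))); first by ring.
    by rewrite ort ort2 mul0r mulr0 subrr.
  move/eqP; rewrite mulf_eq0 => /orP[/eqP //|].
  rewrite paddr_eq0 ?sqr_ge0 // !sqrf_eq0 !subr_eq0 /d1 /e1 /d2 /e2 => /andP[/eqP/addIr A /eqP/addIr B].
  by case: ne; rewrite A B.
have q0 : q1 ^+ 2 + q2 ^+ 2 != 0.
  rewrite paddr_eq0 ?sqr_ge0 // !sqrf_eq0 /q1 /q2 !subr_eq0; apply/negP => /andP[/eqP A /eqP B].
  by case: pv; rewrite A B.
have N : q1 ^+ 2 + q2 ^+ 2 = (d1 + e1) ^+ 2 + (d2 + e2) ^+ 2.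
  apply: (mulfI q0).
  transitivity ((q1 * (d1 + e1) + q2 * (d2 + e2)) ^+ 2).
    have -> : q1 * (d1 + e1) + q2 * (d2 + e2) = q1 ^+ 2 + q2 ^+ 2 by lra.
    by ring.
  transitivity ((q1 ^+ 2 + q2 ^+ 2) * ((d1 + e1) ^+ 2 + (d2 + e2) ^+ 2)
    - (q1 * (d2 + e2) - q2 * (d1 + e1)) ^+ 2); first by ring.
  by rewrite par; ring.
have : (q1 - (d1 + e1)) ^+ 2 + (q2 - (d2 + e2)) ^+ 2 = 0.
  transitivity ((q1 ^+ 2 + q2 ^+ 2) + ((d1 + e1) ^+ 2 + (d2 + e2) ^+ 2)
    - 2 * (q1 * d1 + q2 * d2) - 2 * (q1 * e1 + q2 * e2)); first by ring.
  by rewrite -N -QD -QE; ring.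
move/eqP; rewrite paddr_eq0 ?sqr_ge0 // !sqrf_eq0 !subr_eq0 /q1 /q2 /d1 /d2 /e1 /e2.
by move=> /andP[/eqP A /eqP B]; apply/pair_equal_spec; split=> /=; lra.
Qed.

(** [gap_edge] supplies the lower bounds required by [chain_lt1]; the ends then coincide in the
    fourth corner of a rhombus. *)
Lemma chain_apex s v w w' p p' A B T : gap s v w T w' ->
  gap (~~ s) w v A p -> gap s w' v B p' -> th < T -> A < pi -> B < pi ->
  A + T + B <= 5 * th -> [/\ p = p', A + T = pi, B + T = pi & p = w + w' - v].
Proof.
move=> GT GA GB T1 Api Bpi S; have p0 := pi_gt0 R.
have [[E _]|[_ A1 TA]] := gap_edge penny GT GA; first lra.
have GB' : gap (~~ ~~ s) w' v B p' by rewrite negbK.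
have [[E _]|[_ B1 TB]] := gap_edge penny (gap_rev GT) GB'; first lra.
have pE : p = p'.
  apply: (penny_dist2 penny (gap_tgt GA) (gap_tgt GB)).
  rewrite (gap_turn GA) (gap_turn GB) (chain_dist2 A B (gap_unit GT) (gap_turn GT)).
  by apply: chain_lt1; lra.
have ap : p = w + w' - v.
  apply: rhombus_apex.
  - exact: gap_unit GT.
  - exact: gap_unit_tgt GT.
  - exact: gap_unit_tgt GA.
  - by rewrite pE; exact: gap_unit_tgt GB.
  - move=> E; have := gap_turn GT; rewrite -E -{1}(turn0 v w) -{1}(mulr0 (sg R s)).
    by move/(turn_inj (gap_unit GT)) => H; have := H ltac:(lra) ltac:(lra); lra.
  - move=> E; have := gap_turn GA; rewrite E -{1}(turn0 w v) -{1}(mulr0 (sg R (~~ s))).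
    by move/(turn_inj (gap_unit GA)) => H; have := H ltac:(lra) ltac:(lra); lra.
split=> //.
- rewrite addrC; apply: (gap_of_rhombus penny GT GA) => //; first lra.
  by rewrite (addrC w') -ap (gap_tgt GA).
- rewrite addrC; apply: (gap_of_rhombus penny (gap_rev GT) GB') => //; first lra.
  by rewrite -ap (gap_tgt GA).
Qed.

Lemma fan5_ge s w x1 x2 x3 x4 x5 g1 g2 g3 g4 g5 :
  fan5 s w x1 x2 x3 x4 x5 g1 g2 g3 g4 g5 ->
  [/\ th <= g1, th <= g2, th <= g3, th <= g4 & th <= g5].
Proof.
by case=> *; split; apply: (gap_ge penny); eassumption.
Qed.

Lemma no_three_narrow_gaps s w x y z t : gap s w x th y -> gap s w y th z -> gap s w z th t -> False.
Proof. by move=> G1 G2 G3; apply: (gap3 gen G1 G2 G3); field. Qed.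

Lemma fan5_neq s w x1 x2 x3 x4 x5 g1 g2 g3 g4 g5 :
  fan5 s w x1 x2 x3 x4 x5 g1 g2 g3 g4 g5 ->
  [/\ x2 <> x1, x3 <> x1, x4 <> x1 & x5 <> x1].
Proof.
move=> F; have p0 := pi_gt0 R; have [h1 h2 h3 h4 h5] := fan5_ge F.
have S := fan5_sum F; have d1 := gap_unit (fan5_1 F).
have ne a : 0 < a -> a < 2 * pi -> turn w x1 (sg R s * a) <> x1.
  move=> a0 a2; rewrite -{2}(turn0 w x1) -(mulr0 (sg R s)) => /(turn_inj d1) H.
  by have := H ltac:(lra) ltac:(lra); lra.
have E2 := gap_turn (fan5_1 F).
have E3 := gap_turn (fan5_2 F); rewrite E2 turnD -mulrDr in E3.
have E4 := gap_turn (fan5_3 F); rewrite E3 turnD -mulrDr in E4.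
have E5 := gap_turn (fan5_4 F); rewrite E4 turnD -mulrDr in E5.
by split; rewrite ?E2 ?E3 ?E4 ?E5; apply: ne; lra.
Qed.

Lemma gap_edgeP s w x g y : gap s w x g y -> edge P w x.
Proof. by move=> G; apply/edgeE; split; [exact: gap_center G|exact: gap_src G|exact: gap_unit G]. Qed.

Lemma edge_sym p q : edge P p q -> edge P q p.
Proof. by move/edgeE=> [pP qP d]; apply/edgeE; rewrite dist2C. Qed.

(** The other three gaps take up at least 3 times 60 degrees. *)
Lemma deg5_sides s w x g h p q : deg w = 5%N -> gap s w x g p -> gap (~~ s) w x h q ->
  g + h <= pi.
Proof.
move=> dw G H; have [x2 [x3 [x4 [x5 [g1 [g2 [g3 [g4 [g5 F]]]]]]]]] := fan5_exists s (gap_edgeP G) dw.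
have [E1 _] := gap_uniq G (fan5_1 F); have [E2 _] := gap_uniq H (gap_rev (fan5_5 F)).
by have := fan5_sum F; have [] := fan5_ge F; lra.
Qed.

(** Otherwise the four angles along the edge sum to at least 2 pi by [gap_edge], while each end
    allows at most pi. Equality leaves three consecutive gaps of 60 degrees at [w]. *)
Lemma edge_in_triangle s w x g h p q : deg w = 5%N -> deg x = 5%N ->
  gap s w x g p -> gap (~~ s) w x h q -> g = th \/ h = th.
Proof.
move=> dw dx G H.
have [x2 [x3 [x4 [x5 [g1 [g2 [g3 [g4 [g5 F]]]]]]]]] := fan5_exists s (gap_edgeP G) dw.
have [E1 _] := gap_uniq G (fan5_1 F); have [E2 _] := gap_uniq H (gap_rev (fan5_5 F)).
have [y2 [y3 [y4 [y5 [h1 [h2 [h3 [h4 [h5 K]]]]]]]]] :=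
  fan5_exists s (edge_sym (gap_edgeP G)) dx.
have K5 := gap_rev (fan5_5 K).
have K1 : gap (~~ ~~ s) x w h1 y2 by rewrite negbK; exact: fan5_1 K.
have [[]|[_ _ L1]] := gap_edge penny G K5; first by left.
have [[]|[_ _ L2]] := gap_edge penny H K1; first by right.
have S1 := fan5_sum F; have S2 := fan5_sum K.
have [f1 f2 f3 f4 f5] := fan5_ge F; have [k1 k2 k3 k4 k5] := fan5_ge K.
exfalso; have F2 := fan5_2 F; have F3 := fan5_3 F; have F4 := fan5_4 F.
have e2 : g2 = th by lra.
have e3 : g3 = th by lra.
have e4 : g4 = th by lra.
by rewrite e2 e3 e4 in F2 F3 F4; exact: (no_three_narrow_gaps F2 F3 F4).
Qed.

(* The vertices L, U, R, D of the paper, with M standing for R; s records whether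
   U is on the left or on the right of the diagonal from L to M. *)
Record kern s L U M D : Prop := Kern {
  kern_L : deg L = 5%N; kern_U : deg U = 5%N; kern_M : deg M = 5%N; kern_D : deg D = 5%N;
  kern_up : gap s L M th U; kern_dn : gap (~~ s) L M th D }.

Lemma kern_sym s L U M D : kern s L U M D -> kern (~~ s) L D M U.
Proof. by case=> *; split=> //; rewrite negbK. Qed.

Lemma kern_flip s L U M D : kern s L U M D -> kern (~~ s) M U L D.
Proof. by case=> dL dU dM dD G1 G2; split=> //; apply/gap_rev/gap_tri. Qed.

Lemma gap_gt s w x g y : gap s w x g y -> g <> th -> th < g.
Proof. by move=> G ne; rewrite lt_neqAle (gap_ge penny G) andbT eq_sym; apply/eqP. Qed.

(** Rigidity of a kernel: the wide gaps at [L] and [U] are the same two supplementary angles, and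
    all other gaps there are 60 degrees. *)
Lemma kern_core s L U M D : kern s L U M D -> exists x y g h t1 t2 t3,
  [/\ fan5 s L M U x y D th g th h th, fan5 s U L M t3 t2 t1 th g th th h,
      th < g, th < h & g + h = pi].
Proof.
case=> dL dU dM dD G1 G2.
have [U' [x [y [D' [g1 [g [m [h [g5 F]]]]]]]]] := fan5_exists s (gap_edgeP G1) dL.
have [e eU] := gap_uniq (fan5_1 F) G1; subst U' g1.
have [e eD] := gap_uniq (gap_rev (fan5_5 F)) G2; subst D' g5.
have G1' : gap (~~ s) M L th U by apply/gap_rev/(gap_tri penny).
have G2' : gap s M L th D by rewrite -(negbK s); apply/gap_rev/(gap_tri penny).
have [U' [x' [y' [D' [g1' [g' [m' [h' [g5' K]]]]]]]]] := fan5_exists (~~ s) (gap_edgeP G1') dM.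
have [e eU] := gap_uniq (fan5_1 K) G1'; subst U' g1'.
have K5 := gap_rev (fan5_5 K); rewrite negbK in K5.
have [e eD] := gap_uniq K5 G2'; subst D' g5'.
have GU : gap s U L th M by do 2 apply: (gap_tri penny).
have GD : gap (~~ s) D L th M by do 2 apply: (gap_tri penny).
have [M' [t3 [t2 [t1 [u1 [u2 [k1 [k2 [u5 N]]]]]]]]] := fan5_exists s (gap_edgeP GU) dU.
have [e eM] := gap_uniq (fan5_1 N) GU; subst M' u1.
have [M' [r3 [r2 [r1 [d1 [d2 [l1 [l2 [d5 Q]]]]]]]]] := fan5_exists (~~ s) (gap_edgeP GD) dD.
have [e eM] := gap_uniq (fan5_1 Q) GD; subst M' d1.
have g1 : th < g.
  apply: (gap_gt (fan5_2 F)) => e; rewrite e in F.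
  exact: (no_three_narrow_gaps (fan5_5 F) (fan5_1 F) (fan5_2 F)).
have h1 : th < h.
  apply: (gap_gt (fan5_4 F)) => e; rewrite e in F.
  exact: (no_three_narrow_gaps (fan5_4 F) (fan5_5 F) (fan5_1 F)).
have g1' : th < g'.
  apply: (gap_gt (fan5_2 K)) => e; rewrite e in K.
  exact: (no_three_narrow_gaps (fan5_5 K) (fan5_1 K) (fan5_2 K)).
have h1' : th < h'.
  apply: (gap_gt (fan5_4 K)) => e; rewrite e in K.
  exact: (no_three_narrow_gaps (fan5_4 K) (fan5_5 K) (fan5_1 K)).
(* The outer faces at the four edges of the rim require a total of 4 pi, and each of the four
   vertices offers at most pi. All the inequalities are therefore equalities. *)
have [[]|[_ _ I1]] := gap_edge penny (fan5_2 F) (gap_rev (fan5_5 N)); first by lra.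
have N2 : gap (~~ ~~ s) U M u2 t3 by rewrite negbK; exact: fan5_2 N.
have [[]|[_ _ I2]] := gap_edge penny (fan5_2 K) N2; first by lra.
have [[]|[_ _ I3]] := gap_edge penny (gap_rev (fan5_4 F)) (gap_rev (fan5_5 Q)); first by lra.
have Q2 : gap (~~ ~~ ~~ s) D M d2 r3 by rewrite negbK; exact: fan5_2 Q.
have [[]|[_ _ I4]] := gap_edge penny (gap_rev (fan5_4 K)) Q2; first by lra.
have SF := fan5_sum F; have [f1 f2 f3 f4 f5] := fan5_ge F.
have SK := fan5_sum K; have [c1 c2 c3 c4 c5] := fan5_ge K.
have SN := fan5_sum N; have [n1 n2 n3 n4 n5] := fan5_ge N.
have SQ := fan5_sum Q; have [q1 q2 q3 q4 q5] := fan5_ge Q.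
have gh : g + h = pi by lra.
have em : m = th by lra.
have eu2 : u2 = g by lra.
have eu5 : u5 = h by lra.
have ek1 : k1 = th by lra.
have ek2 : k2 = th by lra.
subst m u2 u5 k1 k2.
by exists x, y, g, h, t1, t2, t3.
Qed.

(* By the symmetries [kern_sym] and [kern_flip], the cases w = M and w = D reduce
   to these two. *)
Definition inK w := exists s L U M D, kern s L U M D /\ (w = L \/ w = U).

Definition rhombic s w v g y := [/\ gap s w v g y, th < g, g < pi, deg y = 5%N & y + v - w \in P].

(** How a kernel vertex [w] sees [v]: a rhombus on one side, a triangle on the other. The last
    alternative separates a vertex on the diagonal ([L], [M]) from one off it ([U], [D]). *)
Definition kernel_side w v := exists s g y z, [/\ rhombic s w v g y, gap (~~ s) w v th z &
  (exists h z', gap (~~ s) w z h z' /\ th < h) \/ (exists x, gap s w y th x /\ deg x = 5%N)].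

Lemma kern_side_L s L U M D v : kern s L U M D -> edge P L v -> deg v <> 5%N ->
  kernel_side L v.
Proof.
move=> K Lv dv; have p0 := pi_gt0 R.
have [x [y [g [h [t1 [t2 [t3 [F N g1 h1 gh]]]]]]]] := kern_core K.
have := fan5_all F Lv; rewrite !inE.
move=> /or4P[/eqP e|/eqP e|/eqP e|/orP[/eqP e|/eqP e]]; subst v.
- by case: dv; exact: kern_M K.
- by case: dv; exact: kern_U K.
- exists (~~ s), g, U, y; rewrite negbK; split; last by left; exists h, D; split=> //; exact: fan5_4 F.
  + split=> //; [exact: gap_rev (fan5_2 F)|lra|exact: kern_U K|].
    by rewrite (addrC U x) -(gap_rhombus (fan5_2 F) (gap_rev (fan5_5 N)) gh); exact: gap_src (fan5_5 N).
  + exact: fan5_3 F.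
- exists s, h, D, x; split; last by left; exists g, U; split=> //; exact: gap_rev (fan5_2 F).
  + split=> //; [exact: fan5_4 F|lra|exact: kern_D K|].
    (* The fan at [D] is obtained as that of [U] in the mirrored kernel. *)
    have [x' [y' [g' [h' [t1' [t2' [t3' [F' N' g1' h1' gh']]]]]]]] := kern_core (kern_sym K).
    have [e1 e2] := gap_uniq (fan5_2 F') (gap_rev (fan5_4 F)); subst g' x'.
    by rewrite (addrC D y) -(gap_rhombus (fan5_2 F') (gap_rev (fan5_5 N')) gh'); exact: gap_src (fan5_5 N').
  + exact: gap_rev (fan5_3 F).
- by case: dv; exact: kern_D K.
Qed.

Lemma kern_side_t1 s L U M D x y g h t1 t2 t3 : kern s L U M D ->
  fan5 s L M U x y D th g th h th -> fan5 s U L M t3 t2 t1 th g th th h ->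
  th < g -> th < h -> g + h = pi -> kernel_side U t1.
Proof.
move=> K F N g1 h1 gh; exists s, h, L, t2; split.
- split=> //; [exact: fan5_5 N|lra|exact: kern_L K|].
  have F2 : gap (~~ ~~ s) L U g x by rewrite negbK; exact: fan5_2 F.
  rewrite addrC in gh; rewrite (addrC L t1).
  by rewrite -(gap_rhombus (gap_rev (fan5_5 N)) F2 gh); exact: gap_src (fan5_3 F).
- exact: gap_rev (fan5_4 N).
- by right; exists M; split; [exact: fan5_1 N|exact: kern_M K].
Qed.

(** The second alternative is for the middle one, [t2], of the three neighbors outside the kernel;
    [t1] and [t3] are exchanged by [kern_flip]. *)
Lemma kern_side_U s L U M D v : kern s L U M D -> edge P U v -> deg v <> 5%N ->
  kernel_side U v \/ (forall s' g y, gap s' U v g y -> g = th).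
Proof.
move=> K Uv dv; have p0 := pi_gt0 R.
have [x [y [g [h [t1 [t2 [t3 [F N g1 h1 gh]]]]]]]] := kern_core K.
have := fan5_all N Uv; rewrite !inE.
move=> /or4P[/eqP e|/eqP e|/eqP e|/orP[/eqP e|/eqP e]]; subst v.
- by case: dv; exact: kern_L K.
- by case: dv; exact: kern_M K.
- left; have [x' [y' [g' [h' [t1' [t2' [t3' [F' N' g1' h1' gh']]]]]]]] := kern_core (kern_flip K).
  have G := gap_rev (fan5_5 N'); rewrite negbK in G.
  have [_ <-] := gap_uniq G (fan5_2 N).
  exact: kern_side_t1 (kern_flip K) F' N' g1' h1' gh'.
- right=> s' g0 y0 G; case: (altP (s' =P s)) => [e|ne].
  + by rewrite e in G; have [] := gap_uniq G (fan5_4 N).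
  + have e : s' = ~~ s by move: ne; case: (s'); case: (s).
    by rewrite e in G; have [] := gap_uniq G (gap_rev (fan5_3 N)).
- by left; exact: kern_side_t1 K F N g1 h1 gh.
Qed.

(** A wide gap next to [v] rules out the second alternative of [kern_side_U] and must be on the side
    of the rhombus. *)
Lemma kernel_gap s w v g y : inK w -> deg v <> 5%N -> gap s w v g y -> th < g ->
  [/\ rhombic s w v g y, (forall h z, gap (~~ s) w v h z -> h = th) &
   forall z h z', gap (~~ s) w v th z -> gap (~~ s) w z h z' -> h = th ->
     exists x, gap s w y th x /\ deg x = 5%N].
Proof.
move=> [s0 [L [U [M [D [K wE]]]]]] dv G g1.
have Ew := gap_edgeP G.
have [s1 [g' [y' [z [[G' g1' gp dy inP] Gz alt]]]]] : kernel_side w v.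
  case: wE => e; subst w; first exact: kern_side_L K Ew dv.
  by have [//|H] := kern_side_U K Ew dv; exfalso; have := H _ _ _ G; lra.
clear K wE.
have e : s = s1.
  case: (altP (s =P s1)) => // ne; have e : s = ~~ s1 by move: ne; case: (s); case: (s1).
  by exfalso; rewrite e in G; have [e1 _] := gap_uniq G Gz; rewrite e1 ltxx in g1.
subst s1; have [e1 e2] := gap_uniq G G'; subst g' y'.
split; first by split.
- by move=> h z' H; have [] := gap_uniq H Gz.
- move=> z1 h z' H1 H2 h1; have [_ e] := gap_uniq H1 Gz; subst z1.
  case: alt => [[h' [z'' [H' lt]]]|ex_a]; last exact: ex_a.
  by have [e _] := gap_uniq H2 H'; exfalso; rewrite -e h1 ltxx in lt.
Qed.

End Kernels.

(** * Vertices of degree 4 *)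

Section Degree4.
Variables (R : realType) (P : {fset R * R}).
Hypotheses (penny : penny_graph P) (gen : general_position P).
Variable v : R * R.
Hypothesis dv : degree P v <> 5%N.
Implicit Types (p q w x y z : R * R) (a b g h u A B T G : R) (s : bool).

Local Notation th := (pi / 3 : R).
Local Notation gap := (gap P).
Local Notation fan5 := (fan5 P).
Local Notation fan4 := (fan4 P).
Local Notation deg := (degree P).
Local Notation inK := (inK P).

Lemma lt00 : ~ (0 : R) < 0.
Proof. by rewrite ltxx. Qed.

Local Ltac contra_lra := intros; exfalso; apply: lt00; lra.

(** What being popular or in a kernel gives for a neighbor of a vertex [v] of degree 4. *)
Definition good w := deg w = 5%N /\
  (inK w \/ forall x, edge P w x -> x <> v -> deg x = 5%N).

(** If the neighbors other than [v] have degree 5, the edges to [x3] and [x5] lie in triangles on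
    their other sides, and these two triangles form a kernel. *)
Lemma good_pattern s w x2 x3 x5 g2 g5 : good w -> gap s w v th x2 ->
  gap s w x2 g2 x3 -> th < g2 -> gap (~~ s) w v g5 x5 -> th < g5 -> inK w.
Proof.
move=> [dw [//|pop]] G1 G2 g2t G5 g5t.
have [y2 [y3 [x4 [y5 [h1 [h2 [g3 [g4 [h5 F]]]]]]]]] := fan5_exists s (gap_edgeP G1) dw.
have [e1 e2] := gap_uniq (fan5_1 F) G1; subst h1 y2.
have [e1 e2] := gap_uniq (fan5_2 F) G2; subst h2 y3.
have [e1 e2] := gap_uniq (gap_rev (fan5_5 F)) G5; subst h5 y5.
have [n2 n3 n4 n5] := fan5_neq penny F.
have d3 := pop _ (gap_edgeP (fan5_3 F)) n3.
have d4 := pop _ (gap_edgeP (fan5_4 F)) n4.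
have d5 := pop _ (gap_edgeP (fan5_5 F)) n5.
have e3 : g3 = th.
  by case: (edge_in_triangle penny gen dw d3 (fan5_3 F) (gap_rev (fan5_2 F))) => // e; contra_lra.
have e4 : g4 = th.
  by case: (edge_in_triangle penny gen dw d5 (fan5_5 F) (gap_rev (fan5_4 F))) => // e; contra_lra.
subst g3 g4; exists s, w, x5, x4, x3; split; last by left.
by split=> //; [exact: fan5_4 F|exact: gap_rev (fan5_3 F)].
Qed.

Lemma kernel_corner s w g G y z : inK w -> gap s w v g y -> th < g ->
  gap (~~ s) v w G z -> g + G = pi.
Proof.
move=> Kw Gw g1 Gv; have [[_ _ gp _ inP] _ _] := kernel_gap penny gen Kw dv Gw g1.
exact: (gap_of_rhombus penny Gw Gv g1 gp inP).
Qed.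

(** The last inequality is strict because a sum of pi would make the two outer neighbors antipodal
    around [w]. *)
Lemma two_wide s w G G' y y' : deg w = 5%N -> gap s v w G y -> gap (~~ s) v w G' y' ->
  th < G -> th < G' -> exists A A' p p',
  [/\ gap (~~ s) w v A p, gap s w v A' p', th < A /\ th < A', pi <= G + A /\ pi <= G' + A' &
      A + A' < pi].
Proof.
move=> dw Gs Gt g1 g2.
have [p' [x3 [x4 [p [A' [g3 [g4 [g5 [A F]]]]]]]]] := fan5_exists s (edge_sym (gap_edgeP Gs)) dw.
have GA := gap_rev (fan5_5 F).
have GA' : gap (~~ ~~ s) w v A' p' by rewrite negbK; exact: fan5_1 F.
have [[]|[_ A1 I1]] := gap_edge penny Gs GA; first by contra_lra.
have [[]|[_ A2 I2]] := gap_edge penny Gt GA'; first by contra_lra.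
exists A, A', p, p'; split=> //; first exact: fan5_1 F.
rewrite lt_neqAle (deg5_sides penny dw GA GA') andbT; apply/eqP.
by apply: (gap2 gen (fan5_5 F) (fan5_1 F)).
Qed.

(** By [two_wide], [G1 + G4] and [G2 + G3] both exceed pi. *)
Lemma no_narrow_gap s w1 w2 w3 w4 G1 G2 G3 G4 : fan4 s v w1 w2 w3 w4 G1 G2 G3 G4 ->
  deg w1 = 5%N -> deg w3 = 5%N -> th < G1 -> th < G2 -> th < G3 -> th < G4 -> False.
Proof.
move=> F d1 d3 t1 t2 t3 t4; have S := fan4_sum F.
have [A [A' [? [? [_ _ _ [I1 I2] I3]]]]] := two_wide d1 (fan4_1 F) (gap_rev (fan4_4 F)) t1 t4.
have [B [B' [? [? [_ _ _ [J1 J2] J3]]]]] := two_wide d3 (fan4_3 F) (gap_rev (fan4_2 F)) t3 t2.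
by contra_lra.
Qed.

(** Here [p] is opposite to [v] in a rhombus. Its five neighbors must be [w], [y], [z], [y'], [w']
    in this order, which gives too many consecutive gaps of 60 degrees. *)
Lemma apex_false s p w w' y z y' z' A : deg p = 5%N ->
  gap s p w th y -> gap s p y th z -> gap (~~ s) p w' th y' -> gap (~~ s) p y' th z' ->
  gap s w p A v -> th < A -> A < pi -> v + p - w = w' -> False.
Proof.
move=> dp G1 G2 H1 H2 GA A1 Api wE.
have [y0 [z0 [t4 [t5 [h1 [h2 [g3 [g4 [g5 F]]]]]]]]] := fan5_exists s (gap_edgeP G1) dp.
have [e1 e2] := gap_uniq (fan5_1 F) G1; subst h1 y0.
have [e1 e2] := gap_uniq (fan5_2 F) G2; subst h2 z0.
have F5 := gap_rev (fan5_5 F).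
have E : A + g5 = pi.
  by apply: (gap_of_rhombus penny GA F5) => //; rewrite wE; exact: gap_src H1.
have := gap_rhombus GA F5 E; rewrite wE => e; subst t5.
have [e1 e2] := gap_uniq (gap_rev (fan5_4 F)) H1; subst g4 t4.
have [e1 e2] := gap_uniq (gap_rev (fan5_3 F)) H2; subst g3.
exact: (no_three_narrow_gaps gen (fan5_1 F) (fan5_2 F) (fan5_3 F)).
Qed.

(** The two triangles at [x] are what [apex_false] needs on one side of the apex [x]. *)
Lemma wide_popular s w x x' A A' : deg w = 5%N ->
  (forall x, edge P w x -> x <> v -> deg x = 5%N) ->
  gap s w v A x -> gap (~~ s) w v A' x' -> th < A -> th < A' ->
  deg x = 5%N /\ exists y z, gap (~~ s) x w th y /\ gap (~~ s) x y th z.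
Proof.
move=> dw pop GA GA' A1 A1'; have p0 := pi_gt0 R.
have [x2 [y [y2 [x5 [h1 [g2 [M [g4 [h5 F]]]]]]]]] := fan5_exists s (gap_edgeP GA) dw.
have [e1 e2] := gap_uniq (fan5_1 F) GA; subst h1 x2.
have [e1 e2] := gap_uniq (gap_rev (fan5_5 F)) GA'; subst h5 x5.
have [n2 n3 n4 n5] := fan5_neq penny F.
have dx := pop _ (gap_edgeP (fan5_2 F)) n2.
have dy := pop _ (gap_edgeP (fan5_3 F)) n3.
have d5 := pop _ (gap_edgeP (fan5_5 F)) n5.
have e2 : g2 = th.
  by case: (edge_in_triangle penny gen dw dx (fan5_2 F) (gap_rev (fan5_1 F))) => // e; contra_lra.
have e4 : g4 = th.
  by case: (edge_in_triangle penny gen dw d5 (fan5_5 F) (gap_rev (fan5_4 F))) => // e; contra_lra.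
subst g2 g4; split=> //.
have M1 : th < M.
  apply: (gap_gt penny (fan5_3 F)) => e; rewrite e in F.
  exact: (no_three_narrow_gaps gen (fan5_2 F) (fan5_3 F) (fan5_4 F)).
have Txy := gap_tri penny (fan5_2 F); have Txw := gap_rev Txy.
have Tyw := gap_tri penny Txy.
have [y0 [z [t4 [t5 [h1 [T [k3 [k4 [H K]]]]]]]]] := fan5_exists (~~ s) (gap_edgeP Txw) dx.
have [e1 e2] := gap_uniq (fan5_1 K) Txw; subst h1 y0.
exists y, z; split=> //.
have [e|/eqP ne] := eqVneq T th; first by rewrite -e; exact: fan5_2 K.
exfalso; have T1 := gap_gt penny (fan5_2 K) ne.
have [x0 [u3 [u4 [u5 [h1 [N2 [l3 [l4 [N1 Q]]]]]]]]] := fan5_exists s (gap_edgeP Tyw) dy.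
have [e1 e2] := gap_uniq (fan5_1 Q) Tyw; subst h1 x0.
(* If [T] were wide, the outer faces of the triangle [w x y] would require 3 pi. But [x] and [y]
   offer at most pi each, and [A + M < pi] because [A'] is wide. *)
have [[]|[_ _ I1]] := gap_edge penny (gap_rev (fan5_1 F)) (gap_rev (fan5_5 K)); first by contra_lra.
have [[]|[_ _ I2]] := gap_edge penny (fan5_3 F) (gap_rev (fan5_5 Q)); first by contra_lra.
have Q2 : gap (~~ ~~ s) y x N2 u3 by rewrite negbK; exact: fan5_2 Q.
have [[]|[_ _ I3]] := gap_edge penny (fan5_2 K) Q2; first by contra_lra.
have SF := fan5_sum F; have [f1 f2 f3 f4 f5] := fan5_ge penny F.
have SK := fan5_sum K; have [c1 c2 c3 c4 c5] := fan5_ge penny K.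
have SQ := fan5_sum Q; have [q1 q2 q3 q4 q5] := fan5_ge penny Q.
by contra_lra.
Qed.

Lemma wide_not_kernel s w A A' x x' : good w -> gap s w v A x -> gap (~~ s) w v A' x' ->
  th < A -> th < A' -> forall x, edge P w x -> x <> v -> deg x = 5%N.
Proof.
move=> [dw [Kw|//]] GA GA' A1 A1'.
by have [_ H _] := kernel_gap penny gen Kw dv GA A1; have := H _ _ GA'; contra_lra.
Qed.

Lemma one_narrow_gap s w1 w2 w3 w4 G2 G3 G4 : fan4 s v w1 w2 w3 w4 th G2 G3 G4 ->
  good w3 -> good w4 -> th < G2 -> th < G3 -> th < G4 -> False.
Proof.
move=> F gd3 gd4 t2 t3 t4; have S := fan4_sum F; have p0 := pi_gt0 R.
have [A [A' [p [p' [GA GA' [A1 A1'] [I1 I2] I3]]]]] :=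
  two_wide gd3.1 (fan4_3 F) (gap_rev (fan4_2 F)) t3 t2.
have [B' [B [q' [q [GB' GB [B1' B1] [J1 J2] J3]]]]] :=
  two_wide gd4.1 (fan4_4 F) (gap_rev (fan4_3 F)) t4 t3.
(* Since [A < pi - A' <= G2] and [B < pi - B' <= G4], the three angles sum to less than
   [G2 + G3 + G4 = 5 * th]. *)
have [||||pq AE BE pE] := chain_apex penny (fan4_3 F) GA GB; try lra.
have GA'' : gap (~~ ~~ s) w3 v A' p' by rewrite negbK.
have [dp [y [z [Y Z]]]] :=
  wide_popular gd3.1 (wide_not_kernel gd3 GA GA'' A1 A1') GA GA'' A1 A1'.
have [dq [y' [z' [Y' Z']]]] :=
  wide_popular gd4.1 (wide_not_kernel gd4 GB GB' B1 B1') GB GB' B1 B1'.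
have GAr := gap_rev GA.
rewrite negbK in Y Z GAr; rewrite -pq in Y' Z'.
apply: (apex_false dp Y Z Y' Z' GAr) => //; first lra.
by rewrite pE (addrC v) subrK (addrC w3) addrK.
Qed.

(** Two narrow gaps at [w2] force a wide one beyond [w1], so [good_pattern] puts [w1] in a kernel.
    The face at [G] is then a rhombus whose angle at [w1] exceeds 60 degrees. *)
Lemma adj_corner s w1 w2 w3 w4 G : gap s v w1 th w2 -> gap s v w2 th w3 ->
  gap (~~ s) v w1 G w4 -> th < G -> good w1 -> deg w2 = 5%N -> G < 2 * th.
Proof.
move=> G1 G2 G4 t4 gd1 d2; have p0 := pi_gt0 R.
have T2 := gap_tri penny G2; have T1 := gap_tri penny G1; have T1' := gap_tri penny T1.
have [v0 [w0 [x [x5 [h1 [h2 [k [k4 [k5 F]]]]]]]]] := fan5_exists s (gap_edgeP T2) d2.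
have [e1 e2] := gap_uniq (fan5_1 F) T2; subst h1 v0.
have [e1 e2] := gap_uniq (fan5_2 F) T1'; subst h2 w0.
have k1 : th < k.
  apply: (gap_gt penny (fan5_3 F)) => e; rewrite e in F.
  exact: (no_three_narrow_gaps gen (fan5_1 F) (fan5_2 F) (fan5_3 F)).
have Tr := gap_rev T1.
have [w0 [a0 [b [c [h1 [g2 [g3 [g4 [g5 K]]]]]]]]] := fan5_exists (~~ s) (gap_edgeP Tr) gd1.1.
have [e1 e2] := gap_uniq (fan5_1 K) Tr; subst h1 w0.
have [[]|[_ g2t _]] := gap_edge penny (fan5_3 F) (fan5_2 K); first by contra_lra.
have K5 := gap_rev (fan5_5 K).
have [[]|[_ g5t _]] := gap_edge penny G4 K5; first by contra_lra.
have Kw := good_pattern gd1 Tr (fan5_2 K) g2t K5 g5t.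
have G4' : gap (~~ ~~ ~~ s) v w1 G w4 by rewrite negbK.
by have := kernel_corner Kw K5 g5t G4'; lra.
Qed.

Lemma two_adjacent_narrow_gaps s w1 w2 w3 w4 G3 G4 : fan4 s v w1 w2 w3 w4 th th G3 G4 ->
  good w1 -> deg w2 = 5%N -> good w3 -> th < G3 -> th < G4 -> False.
Proof.
move=> F g1 d2 g3 t3 t4; have S := fan4_sum F.
have L4 := adj_corner (fan4_1 F) (fan4_2 F) (gap_rev (fan4_4 F)) t4 g1 d2.
have F3 : gap (~~ ~~ s) v w3 G3 w4 by rewrite negbK; exact: fan4_3 F.
have L3 := adj_corner (gap_rev (fan4_2 F)) (gap_rev (fan4_1 F)) F3 t3 g3 d2.
by contra_lra.
Qed.

(** Since [G2] is at least 120 degrees, its face is no rhombus at a kernel vertex, so [w2] is in no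
    kernel. This determines the gaps around [w2] and a triangle [w1 w2 z]. *)
Lemma opposite_half s w1 w2 w3 w4 G2 G4 : gap s v w2 G2 w3 -> gap (~~ s) v w2 th w1 ->
  gap (~~ s) v w1 G4 w4 -> 2 * th <= G2 -> th < G4 -> good w1 -> good w2 ->
  exists A p G q z, [/\ gap (~~ s) w2 v A p, gap s w1 v G q, th < A /\ th < G,
    A + G <= pi & gap (~~ s) w1 v th w2 /\ gap (~~ s) w1 w2 th z].
Proof.
move=> GG2 GG1 GG4 t2 t4 gd1 gd2; have p0 := pi_gt0 R.
have T2 := gap_tri penny GG1; have T1 := gap_tri penny T2.
have Tr := gap_rev T2; rewrite negbK in Tr.
have [w0 [z [a0 [b [h1 [g2 [g3 [g4 [A F]]]]]]]]] := fan5_exists s (gap_edgeP Tr) gd2.1.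
have [e1 e2] := gap_uniq (fan5_1 F) Tr; subst h1 w0.
have GA := gap_rev (fan5_5 F).
have [[]|[_ A1 _]] := gap_edge penny GG2 GA; first by contra_lra.
have notK : ~ inK w2.
  move=> Kw; have GG2' : gap (~~ ~~ s) v w2 G2 w3 by rewrite negbK.
  by have := kernel_corner Kw GA A1 GG2'; contra_lra.
have pop : forall x, edge P w2 x -> x <> v -> deg x = 5%N by case: gd2 => _ [].
have e2 : g2 = th.
  have [//|/eqP ne] := eqVneq g2 th; case: notK.
  exact: good_pattern gd2 Tr (fan5_2 F) (gap_gt penny (fan5_2 F) ne) GA A1.
subst g2; have [n2 n3 n4 n5] := fan5_neq penny F.
have dz := pop _ (gap_edgeP (fan5_3 F)) n3.
have db := pop _ (gap_edgeP (fan5_5 F)) n5.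
have g31 : th < g3.
  apply: (gap_gt penny (fan5_3 F)) => e; rewrite e in F.
  exact: (no_three_narrow_gaps gen (fan5_1 F) (fan5_2 F) (fan5_3 F)).
have e4 : g4 = th.
  by case: (edge_in_triangle penny gen gd2.1 db (fan5_5 F) (gap_rev (fan5_4 F))) => // e; contra_lra.
subst g4.
have Tz := gap_tri penny (fan5_2 F); have Tz' := gap_tri penny Tz; have T1z := gap_rev Tz.
have [w0 [z0 [a1 [b1 [h1 [h2 [m [k [G K]]]]]]]]] := fan5_exists (~~ s) (gap_edgeP T1) gd1.1.
have [e1 e2] := gap_uniq (fan5_1 K) T1; subst h1 w0.
have [e1 e2] := gap_uniq (fan5_2 K) T1z; subst h2 z0.
have GG := gap_rev (fan5_5 K).
have [[]|[_ G1 _]] := gap_edge penny GG4 GG; first by contra_lra.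
have m1 : th < m.
  apply: (gap_gt penny (fan5_3 K)) => e; rewrite e in K.
  exact: (no_three_narrow_gaps gen (fan5_1 K) (fan5_2 K) (fan5_3 K)).
have [w0 [c1 [c2 [c3 [h1 [k1 [l1 [l2 [k2 N]]]]]]]]] := fan5_exists s (gap_edgeP Tz') dz.
have [e1 e2] := gap_uniq (fan5_1 N) Tz'; subst h1 w0.
(* The outer faces at [w2 z] and [w1 z], with at most pi available at [z], give [g3 + m >= pi].
   Since [A + g3 = pi] and [G + m <= pi], the bound on [A + G] follows. *)
have [[]|[_ _ I1]] := gap_edge penny (fan5_3 F) (gap_rev (fan5_5 N)); first by contra_lra.
have N2 : gap (~~ ~~ s) z w1 k1 c1 by rewrite negbK; exact: fan5_2 N.
have [[]|[_ _ I2]] := gap_edge penny (fan5_3 K) N2; first by contra_lra.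
rewrite negbK in GG.
exists A, b, G, b1, z; split=> //.
have SF := fan5_sum F; have [? ? ? ? ?] := fan5_ge penny F.
have SK := fan5_sum K; have [? ? ? ? ?] := fan5_ge penny K.
have SN := fan5_sum N; have [? ? ? ? ?] := fan5_ge penny N.
by lra.
Qed.

(** The cross product of [w' - w] and [z + y - w - w] is the combination of sines in [key] times the
    squared length of [vw]. *)
Lemma rhombi_collinear s w w' z y G : dist2 v w = 1 -> w <> w' ->
  w' = turn v w (sg R (~~ s) * (G + th)) ->
  z = turn w v (sg R (~~ s) * (th + th)) -> y = turn w v (sg R s * (pi - G + th)) ->
  collinear w w' (z + y - w).
Proof.
move=> d1 ne e' ez ea.
exists (w.2 - w'.2), (w'.1 - w.1), ((w.2 - w'.2) * w.1 + (w'.1 - w.1) * w.2); split.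
  case=> /eqP; rewrite subr_eq0 => /eqP A /eqP; rewrite subr_eq0 => /eqP B; apply: ne.
  by rewrite (surjective_pairing w) A -B -surjective_pairing.
split; rewrite /on_line //; first by ring.
apply/eqP; rewrite -subr_eq0; apply/eqP.
have key : sin (sg R (~~ s) * (th + th)) + sin (sg R s * (pi - G + th))
    - sin (sg R (~~ s) * (th + th) - sg R (~~ s) * (G + th))
    - sin (sg R s * (pi - G + th) - sg R (~~ s) * (G + th)) = 0.
  rewrite sgN !mulNr opprK.
  have -> : - (sg R s * (th + th)) + sg R s * (G + th) = sg R s * (G - th) by ring.
  have -> : sg R s * (pi - G + th) + sg R s * (G + th) = sg R s * (th + th + pi) by ring.
  have -> : pi - G + th = pi - (G - th) by ring.
  by rewrite sinN !sin_sgM sinDpi sinB sinpi cospi; ring.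
rewrite !sinB in key.
transitivity ((sin (sg R (~~ s) * (th + th)) + sin (sg R s * (pi - G + th))
  - (sin (sg R (~~ s) * (th + th)) * cos (sg R (~~ s) * (G + th))
     - cos (sg R (~~ s) * (th + th)) * sin (sg R (~~ s) * (G + th)))
  - (sin (sg R s * (pi - G + th)) * cos (sg R (~~ s) * (G + th))
     - cos (sg R s * (pi - G + th)) * sin (sg R (~~ s) * (G + th)))) * dist2 v w).
  by rewrite e' ez ea /turn /dist2 /=; ring.
by rewrite key mul0r.
Qed.

(** Serves to show that the corner of [rhombi_collinear] is not a neighbor of [v]. *)
Lemma rhombi_dist2 s w z y G : dist2 v w = 1 ->
  z = turn w v (sg R (~~ s) * (th + th)) -> y = turn w v (sg R s * (pi - G + th)) ->
  dist2 v (z + y - w) = 4 + 2 * cos (G - th) + 2 * cos G.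
Proof.
move=> d1 ez ea.
transitivity ((1 + (cos (sg R (~~ s) * (th + th)) ^+ 2 + sin (sg R (~~ s) * (th + th)) ^+ 2)
  + (cos (sg R s * (pi - G + th)) ^+ 2 + sin (sg R s * (pi - G + th)) ^+ 2)
  - 2 * cos (sg R (~~ s) * (th + th)) - 2 * cos (sg R s * (pi - G + th))
  + 2 * (cos (sg R (~~ s) * (th + th)) * cos (sg R s * (pi - G + th))
       + sin (sg R (~~ s) * (th + th)) * sin (sg R s * (pi - G + th)))) * dist2 v w).
  by rewrite ez ea /turn /dist2 /=; ring.
rewrite !cos2Dsin2 d1 -cosB.
have -> : sg R (~~ s) * (th + th) - sg R s * (pi - G + th) = sg R (~~ s) * (pi + pi - G).
  by rewrite sgN; field.
rewrite !cos_sgM.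
have -> : cos (pi + pi - G) = cos G by rewrite -cosN opprB -[LHS]cosD2pi mulr2n subrK.
have -> : cos (pi - G + th) = - cos (G - th).
  by rewrite (_ : pi - G + th = pi - (G - th)) ?(cosB pi) ?cospi ?sinpi; ring.
have -> : cos (th + th) = - (1 / 2).
  by rewrite (_ : th + th = pi - th) ?(cosB pi) ?cospi ?sinpi ?cos_pi3; field.
by field.
Qed.

(** The analogue of [wide_popular] with no slack at [w1]: here the angle inequalities can all be
    equalities, and three collinear vertices are needed for the contradiction. *)
Lemma apex_half s w1 w2 w3 w4 z q G A : gap (~~ s) v w1 G w4 -> gap (~~ s) v w4 th w3 ->
  gap (~~ s) w1 v th w2 -> gap (~~ s) w1 w2 th z -> gap s w1 v A q ->
  A + G = pi -> th < G -> th < A -> good w1 ->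
  deg q = 5%N /\ exists y z, gap (~~ s) q w1 th y /\ gap (~~ s) q y th z.
Proof.
move: q => b1 GG G3 T1 T2 GA AG G1 A1 gd1; have p0 := pi_gt0 R.
have [b0 [a1 [z0 [w0 [h1 [k [M [g4 [g5 F]]]]]]]]] := fan5_exists s (gap_edgeP GA) gd1.1.
have [e1 e2] := gap_uniq (fan5_1 F) GA; subst h1 b0.
have [e1 e2] := gap_uniq (gap_rev (fan5_5 F)) T1; subst g5 w0.
have [e1 e2] := gap_uniq (gap_rev (fan5_4 F)) T2; subst g4 z0.
(* In the kernel case, the two narrow gaps [T1] and [T2] trigger the last clause of [kernel_gap]. *)
have [db [da ek]] : deg b1 = 5%N /\ deg a1 = 5%N /\ k = th.
  case: gd1 => d1 [Kw|pop].
  - have [[_ _ _ db _] _ H] := kernel_gap penny gen Kw dv GA A1; split=> //.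
    have [x [Gx dx]] := H _ _ _ T1 T2 erefl.
    by have [e1 e2] := gap_uniq (fan5_2 F) Gx; subst.
  - have [n2 n3 _ _] := fan5_neq penny F.
    have db := pop _ (gap_edgeP (fan5_2 F)) n2.
    have da := pop _ (gap_edgeP (fan5_3 F)) n3.
    do 2 split=> //.
    by case: (edge_in_triangle penny gen d1 db (fan5_2 F) (gap_rev GA)) => // e; contra_lra.
subst k; split=> //.
have SF := fan5_sum F; have M1 : M = G by lra.
have Tb := gap_tri penny (fan5_2 F); have Tb' := gap_rev Tb; have Ta := gap_tri penny Tb.
have [a0 [d [t4 [t5 [h1 [T [t2 [t3 [H K]]]]]]]]] := fan5_exists (~~ s) (gap_edgeP Tb') db.
have [e1 e2] := gap_uniq (fan5_1 K) Tb'; subst h1 a0.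
exists a1, d; split=> //.
have [e|/eqP ne] := eqVneq T th; first by rewrite -e; exact: fan5_2 K.
exfalso; have T1' := gap_gt penny (fan5_2 K) ne.
have [b0 [u3 [u4 [c1 [h1 [N2 [l3 [l4 [N1 Q]]]]]]]]] := fan5_exists s (gap_edgeP Ta) da.
have [e1 e2] := gap_uniq (fan5_1 Q) Ta; subst h1 b0.
have [[]|[_ _ I1]] := gap_edge penny (gap_rev GA) (gap_rev (fan5_5 K)); first by contra_lra.
have [[]|[_ _ I2]] := gap_edge penny (fan5_3 F) (gap_rev (fan5_5 Q)); first by contra_lra.
have Q2 : gap (~~ ~~ s) a1 b1 N2 u3 by rewrite negbK; exact: fan5_2 Q.
have [[]|[_ _ I3]] := gap_edge penny (fan5_2 K) Q2; first by contra_lra.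
have SK := fan5_sum K; have [? ? ? ? ?] := fan5_ge penny K.
have SQ := fan5_sum Q; have [? ? ? ? ?] := fan5_ge penny Q.
(* As [A + M = pi], all the inequalities are tight, so the face between [a1] and [z] is a rhombus;
   its corner is collinear with [w1] and [w3]. *)
have MN : M + N1 = pi by lra.
have cE := gap_rhombus (fan5_3 F) (gap_rev (fan5_5 Q)) MN.
have cP := gap_src (fan5_5 Q).
have d1 := gap_unit GG.
have w3E : w3 = turn v w1 (sg R (~~ s) * (G + th)).
  by rewrite mulrDr -turnD -(gap_turn GG) -(gap_turn G3).
have zE : z = turn w1 v (sg R (~~ s) * (th + th)).
  by rewrite mulrDr -turnD -(gap_turn T1) -(gap_turn T2).
have aE : a1 = turn w1 v (sg R s * (pi - G + th)).
  have -> : pi - G = A by lra.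
  by rewrite mulrDr -turnD -(gap_turn GA) -(gap_turn (fan5_2 F)).
have n13 : w1 <> w3.
  move=> e; have : turn v w1 (sg R (~~ s) * 0) = turn v w1 (sg R (~~ s) * (G + th)).
    by rewrite mulr0 turn0 -w3E.
  by move/(turn_inj d1) => E; have := E ltac:(lra) ltac:(lra); contra_lra.
apply: (gen (gap_src GG) (gap_tgt G3) cP n13); last 1 first.
- by rewrite cE; apply: rhombi_collinear d1 n13 w3E zE aE.
- have Q5 := gap_rev (fan5_5 Q); move=> e; have := gap_turn Q5; rewrite -e.
  rewrite -{1}(turn0 a1 w1) -{1}(mulr0 (sg R (~~ s))) => /(turn_inj (gap_unit Q5)) E.
  by have := E ltac:(lra) ltac:(lra); contra_lra.
(* The squared distance from [v] to the corner exceeds 2, so the corner is not [w3]. *)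
- move=> e; have := rhombi_dist2 d1 zE aE; rewrite -cE -e (gap_unit_tgt G3 : dist2 v w3 = 1).
  have c1' : 0 < cos (G - th) by apply: cos_gt0_pihalf; apply/andP; split; lra.
  have c2' := cos_geN1 G.
  by contra_lra.
Qed.

Lemma two_opposite_narrow_gaps s w1 w2 w3 w4 G2 G4 : fan4 s v w1 w2 w3 w4 th G2 th G4 ->
  good w1 -> good w2 -> good w3 -> good w4 -> 2 * th <= G2 -> th < G4 -> False.
Proof.
move=> F g1 g2 g3 g4 t2 t4; have S := fan4_sum F; have p0 := pi_gt0 R.
have F2 : gap (~~ ~~ s) v w2 G2 w3 by rewrite negbK; exact: fan4_2 F.
have F3 : gap (~~ ~~ s) v w3 th w4 by rewrite negbK; exact: fan4_3 F.
have F4 : gap (~~ ~~ s) v w4 G4 w1 by rewrite negbK; exact: fan4_4 F.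
have [A [b [G [b1 [z [GA GG [A1 G1] AG [T1 T2]]]]]]] :=
  opposite_half (fan4_2 F) (gap_rev (fan4_1 F)) (gap_rev (fan4_4 F)) t2 t4 g1 g2.
have [A' [b' [G' [b1' [z' [GA' GG' [A1' G1'] AG' [T1' T2']]]]]]] :=
  opposite_half (gap_rev (fan4_2 F)) F3 F4 t2 t4 g4 g3.
rewrite negbK in GA'.
(* The angle sums of the two chains total at most [10 * th], so one is at most [5 * th]. It is not
   the one at [G2]: a rhombus there contradicts [2 * th <= G2] and [th < A]. *)
have [L|L] := lerP (A + G2 + A') (5 * th).
  have [||||_ AE _ _] := chain_apex penny (fan4_2 F) GA GA'; try lra.
have GGn : gap (~~ ~~ s) w1 v G b1 by rewrite negbK.
have [||||bE GE GE' bap] := chain_apex penny (gap_rev (fan4_4 F)) GGn GG'; try lra.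
have [db [y [x [Y X]]]] :=
  apex_half (gap_rev (fan4_4 F)) (gap_rev (fan4_3 F)) T1 T2 GG GE t4 G1 g1.
have F1 : gap (~~ ~~ s) v w1 th w2 by rewrite negbK; exact: fan4_1 F.
have [db' [y' [x' [Y' X']]]] := apex_half F4 F1 T1' T2' GG' GE' t4 G1' g4.
rewrite -bE in Y' X'.
apply: (apex_false db Y X Y' X' (gap_rev GG) G1) => //; first lra.
by rewrite bap (addrC v) subrK (addrC w1) addrK.
Qed.

Lemma fan4_rot s w1 w2 w3 w4 G1 G2 G3 G4 : fan4 s v w1 w2 w3 w4 G1 G2 G3 G4 ->
  fan4 s v w2 w3 w4 w1 G2 G3 G4 G1.
Proof. by case=> ? ? ? ? E; split=> //; rewrite -E; ring. Qed.

Lemma no_good_fan4 s w1 w2 w3 w4 G1 G2 G3 G4 : fan4 s v w1 w2 w3 w4 G1 G2 G3 G4 ->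
  good w1 -> good w2 -> good w3 -> good w4 -> False.
Proof.
move=> F g1 g2 g3 g4; have p0 := pi_gt0 R.
wlog G1E : w1 w2 w3 w4 G1 G2 G3 G4 F g1 g2 g3 g4 / G1 = th.
  move=> W.
  have [e1|/eqP n1] := eqVneq G1 th; first exact: (W _ _ _ _ _ _ _ _ F).
  have [e2|/eqP n2] := eqVneq G2 th; first exact: (W _ _ _ _ _ _ _ _ (fan4_rot F)).
  have [e3|/eqP n3] := eqVneq G3 th; first exact: (W _ _ _ _ _ _ _ _ (fan4_rot (fan4_rot F))).
  have [e4|/eqP n4] := eqVneq G4 th.
    exact: (W _ _ _ _ _ _ _ _ (fan4_rot (fan4_rot (fan4_rot F)))).
  exact: (no_narrow_gap F g1.1 g3.1 (gap_gt penny (fan4_1 F) n1) (gap_gt penny (fan4_2 F) n2)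
    (gap_gt penny (fan4_3 F) n3) (gap_gt penny (fan4_4 F) n4)).
subst G1.
have ge2 := gap_ge penny (fan4_2 F); have ge4 := gap_ge penny (fan4_4 F).
have S := fan4_sum F.
have [e2|/eqP n2] := eqVneq G2 th.
  subst G2; have n3 : G3 <> th.
    by move=> e; subst G3; exact: (no_three_narrow_gaps gen (fan4_1 F) (fan4_2 F) (fan4_3 F)).
  have n4 : G4 <> th.
    by move=> e; subst G4; exact: (no_three_narrow_gaps gen (fan4_4 F) (fan4_1 F) (fan4_2 F)).
  exact: (two_adjacent_narrow_gaps F g1 g2.1 g3 (gap_gt penny (fan4_3 F) n3) (gap_gt penny (fan4_4 F) n4)).
have t2 := gap_gt penny (fan4_2 F) n2.
have [e4|/eqP n4] := eqVneq G4 th.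
  subst G4; have n3 : G3 <> th.
    by move=> e; subst G3; exact: (no_three_narrow_gaps gen (fan4_3 F) (fan4_4 F) (fan4_1 F)).
  exact: (two_adjacent_narrow_gaps (fan4_rot (fan4_rot (fan4_rot F))) g4 g1.1 g2
    (gap_gt penny (fan4_2 F) n2) (gap_gt penny (fan4_3 F) n3)).
have t4 := gap_gt penny (fan4_4 F) n4.
have [e3|/eqP n3] := eqVneq G3 th; last first.
  exact: (one_narrow_gap F g3 g4 t2 (gap_gt penny (fan4_3 F) n3) t4).
(* As [G2 + G4 = 4 * th], one of the two is at least [2 * th]. *)
subst G3; have [L|L] := lerP (2 * th) G2.
  exact: (two_opposite_narrow_gaps F g1 g2 g3 g4 L t4).
by apply: (two_opposite_narrow_gaps (fan4_rot (fan4_rot F)) g3 g4 g1 g2 _ t2); lra.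
Qed.

End Degree4.

(** * Reduction of the theorem to four good neighbors *)

Section Conclusion.
Variables (R : realType) (P : {fset R * R}).
Hypotheses (penny : penny_graph P) (gen : general_position P).
Local Notation th := (pi / 3 : R).

(** The angle at [l] has cosine 1/2, so it is 60 degrees in one of the two orientations. *)
Lemma common_neighbor (l r u : R * R) : edge P l r -> edge P l u -> edge P u r ->
  exists s, gap P s l r th u.
Proof.
move=> /edgeE[lP rP lr] /edgeE[_ uP lu] /edgeE[_ _ ur]; have p0 := pi_gt0 R.
have mk s : u = turn l r (sg R s * th) -> gap P s l r th u.
  move=> uE; split=> //; first lra.
  move=> a a0 at'; apply/negP => aP.
  by have := turn_ge penny lP rP lr a0 ltac:(lra) aP; rewrite leNgt at'.
have [a [a0 a2 uE]] := turn_exists true lr lu.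
have ca : cos a = cos th.
  have := dist2_turn2 l r (sg R true * a) (sg R true * 0).
  rewrite -mulrBr cos_sgM subr0 mulr0 turn0 -uE ur lr cos_pi3; lra.
have [api|api] := lerP a pi.
  exists true; apply: mk; rewrite uE; congr (turn _ _ (_ * _)).
  by apply: cos_inj ca; rewrite in_itv /=; apply/andP; split; lra.
exists false; apply: mk.
have aE : 2 * pi - a = th.
  have ca' : cos (2 * pi - a) = cos th.
    by rewrite mulr_natl -cosN opprB -[LHS]cosD2pi subrK.
  by apply: cos_inj ca'; rewrite in_itv /=; apply/andP; split; lra.
have -> : sg R false * th = sg R true * a + sg R false * (2 * pi).
  by rewrite -aE /sg; ring.
by rewrite -turnD turn2pi.
Qed.

Lemma kernel_inK (K : {fset R * R}) w : kernel P K -> w \in K -> inK P w.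
Proof.
case=> l [u [r [d [-> card dK [lu ur rd dl lr]]]]].
have ud : u != d.
  apply/eqP => e; move: card; rewrite e.
  have -> : [fset l; d; r; d] = [fset l; d; r] by apply/fsetP => x; rewrite !inE; do 3 case: (_ == _).
  by move=> card; have := cardfsU1 r [fset l; d]; rewrite fsetUC card cardfs2; case: (_ \notin _); case: (_ != _).
have [s Gu] := common_neighbor lr lu ur.
have [s' Gd] := common_neighbor lr (edge_sym dl) (edge_sym rd).
(* On the same side of [l r], the vertices [u] and [d] would coincide. *)
have es : s' = ~~ s.
  case: (altP (s' =P s)) => [e|]; last by case: (s'); case: (s).
  by rewrite e in Gd; have [_ e'] := gap_uniq Gu Gd; rewrite e' eqxx in ud.
subst s'.
have dg x : x \in [fset l; u; r; d] -> degree P x = 5%N by move=> /dK[].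
have K0 : kern P s l u r d by split=> //; apply: dg; rewrite !inE eqxx ?orbT.
rewrite !inE -!orbA => /or4P[]/eqP->.
- by exists s, l, u, r, d; split=> //; left.
- by exists s, l, u, r, d; split=> //; right.
- by exists (~~ s), r, u, l, d; split; [exact: kern_flip|left].
- by exists (~~ s), l, d, r, u; split; [exact: kern_sym|right].
Qed.

(** The single neighbor of degree 4 allowed to a popular vertex is already [v]. *)
Lemma popular_neighbors v w : degree P v = 4%N -> edge P w v -> popular P w ->
  forall x, edge P w x -> x <> v -> degree P x = 5%N.
Proof.
move=> dv wv [_ card oth] x wx xv.
have nb y : edge P w y -> y \in neighbors P w by move=> /edgeE E; apply/neighborsE.
have [d4|/eqP d4] := eqVneq (degree P x) 4%N; last by apply: oth => //; exact: nb.
have : [fset x; v] `<=` [fset u in neighbors P w | degree P u == 4%N].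
  apply/fsubsetP => y; rewrite !inE => /orP[]/eqP->.
  - by have := nb _ wx; rewrite /neighbors !inE d4 eqxx => ->.
  - by have := nb _ wv; rewrite /neighbors !inE dv eqxx => ->.
move/fsubset_leq_card => /leq_trans/(_ card).
by rewrite cardfs2; move/eqP: xv => ->.
Qed.

End Conclusion.

Theorem theorem5 (R : realType) (P : {fset R * R}) (v : R * R) :
  penny_graph P -> general_position P ->
  v \in P -> degree P v = 4%N ->
  exists w : R * R,
    [/\ w \in neighbors P v, unpopular P w &
        ~ (exists K : {fset R * R}, kernel P K /\ w \in K)].
Proof.
move=> penny gen vP dv; apply: contrapT => none.
have dv5 : degree P v <> 5%N by rewrite dv.
have all_good w : edge P v w -> good P v w.
  move=> vw; have wN : w \in neighbors P v by apply/neighborsE/edgeE.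
  have [pw|up] := EM (popular P w).
    split; first by case: pw.
    by right; exact: popular_neighbors dv (edge_sym vw) pw.
  have [[K [Kk wK]]|nK] := EM (exists K : {fset R * R}, kernel P K /\ w \in K).
    split; last by left; exact: kernel_inK Kk wK.
    by case: Kk wK => l [u [r [d [_ _ dK _]]]] /dK[].
  by case: none; exists w.
have [w1 w1N] : exists w1, w1 \in neighbors P v.
  by apply/fset0Pn; rewrite -cardfs_gt0 -/(degree P v) dv.
have v1 : edge P v w1 by apply/edgeE/neighborsE.
have [w2 [w3 [w4 [G1 [G2 [G3 [G4 F]]]]]]] := fan4_exists true v1 dv.
apply: (no_good_fan4 penny gen dv5 F); apply: all_good.
- exact: gap_edgeP (fan4_1 F).
- exact: gap_edgeP (fan4_2 F).
- exact: gap_edgeP (fan4_3 F).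
- exact: gap_edgeP (fan4_4 F).
Qed.
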